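(* Let $n\ge3$, $\alpha\in(0,n)$, $p,q>0$ with $pq>1$, and assume $\frac{1}{p+1}+\frac{1}{q+1}\le\frac{n-\alpha}{n}$. If $(u,v)\in L^{r_0}(\mathbb{R}^n)\times L^{s_0}(\mathbb{R}^n)$, where $r_0=\frac{n(pq-1)}{\alpha(q+1)}$, $s_0=\frac{n(pq-1)}{\alpha(p+1)}$, is a pair of positive solutions of $$u(x)=\int_{\mathbb{R}^n}\frac{v^q(y)\,dy}{|x-y|^{n-\alpha}},\qquad v(x)=\int_{\mathbb{R}^n}\frac{u^p(y)\,dy}{|x-y|^{n-\alpha}},$$ then $(u,v)\in L^{p+1}(\mathbb{R}^n)\times L^{q+1}(\mathbb{R}^n)$.
   Context: Positive solutions are positive measurable functions satisfying both integral identities (finite) at every point. *)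

(* Defs.v *)
From HB Require Import structures.
From mathcomp Require Import all_boot all_order all_algebra.
From mathcomp Require Import all_classical all_reals all_analysis.
Set Implicit Arguments. Unset Strict Implicit. Unset Printing Implicit Defensive.
Import Order.TTheory GRing.Theory Num.Theory.
Local Open Scope classical_set_scope.
Local Open Scope ring_scope.

(* Points of R^n are n-tuples of reals; n.-tuple R carries the product
   (= Borel) sigma-algebra from MathComp-Analysis. *)

Definition edist (R : realType) (n : nat) (x y : n.-tuple R) : R :=
  Num.sqrt (\sum_(i < n) (tnth x i - tnth y i) ^+ 2).

(* Lebesgue integral over R^n of a function with values in \bar R, defined
   as the iterated one-dimensional Lebesgue integral (by Tonelli this is the
   Lebesgue integral on R^n for nonnegative measurable functions, which is the
   only case used here). *)
Fixpoint integralRn (R : realType) (n : nat) : (n.-tuple R -> \bar R) -> \bar R :=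
  match n with
  | 0 => fun f => f [tuple]
  | n'.+1 => fun f =>
      (\int[@lebesgue_measure R]_(t in [set: R])
         integralRn (fun x : n'.-tuple R => f [tuple of t :: x]))%E
  end.

Definition inLp (R : realType) (n : nat) (r : R) (f : n.-tuple R -> R) : Prop :=
  measurable_fun [set: n.-tuple R] f /\
  (integralRn (fun x => (`|f x| `^ r)%:E) < +oo)%E.

Definition riesz (R : realType) (n : nat) (alpha : R) (g : n.-tuple R -> R)
  (x : n.-tuple R) : \bar R :=
  integralRn (fun y => (g y / (edist x y `^ (n%:R - alpha)))%:E).

(* Main.v *)
Require Import Defs.
From HB Require Import structures.
From mathcomp Require Import all_boot all_order all_algebra.
From mathcomp Require Import all_classical all_reals all_analysis.
From mathcomp Require Import measurable_realfun.
From mathcomp Require Import ring lra.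
Import Order.TTheory GRing.Theory Num.Theory.
Import numFieldNormedType.Exports.
Local Open Scope classical_set_scope.
Local Open Scope ring_scope.
Set Implicit Arguments. Unset Strict Implicit. Unset Printing Implicit Defensive.

(* Regularity lifting for v. Since u = I(v^q) and v = I(u^p), where I is the
   Riesz potential of order alpha, v = T v + F with
   T w = I(u_d^(p - 1/q) (I(w^q))^(1/q)), u_d = u 1_{u <= d},
   F = I(u^p 1_{u > d}). By the Hardy-Littlewood-Sobolev inequality T maps
   L^s0 and L^(q+1) to themselves with norm controlled by the L^r0 norm of
   u_d, which is small for small d, and F lies in L^(q+1). Because T is
   monotone, homogeneous and quasi-subadditive, iterating gives v <= a + b
   with a bounded in L^(q+1) and b as small as desired in L^s0; as
   q + 1 <= s0, this bounds the integral of v^(q+1) over every {v > d}.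
   Working with T rather than with a pair of operators treats all p, q > 0
   with pq > 1 at once, so the claim for u follows by exchanging the roles.

   The Hardy-Littlewood-Sobolev inequality is used in the bilinear form
   int int phi(x)^s psi(y)^t |x - y|^(alpha - n) <= C (int phi)^s (int psi)^t,
   s + t = 1 + alpha/n. As |x - y| dominates every |x_i - y_i|, the kernel is
   at most the product of the one-dimensional kernels |x_i - y_i|^(alpha/n - 1),
   and iterating the integrals reduces the inequality to dimension one. *)

(** * Lebesgue measure on tuples *)

Definition tuple_cons (R : realType) (n : nat)
    (z : measurableTypeR R * n.-tuple R) : n.+1.-tuple R :=
  [tuple of z.1 :: z.2].

Lemma measurable_tuple_cons (R : realType) (n : nat) :
  measurable_fun [set: measurableTypeR R * n.-tuple R] (@tuple_cons R n).
Proof. by apply: measurable_cons; [exact: measurable_fst|exact: measurable_snd]. Qed.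

Definition cons_measure (R : realType) (n : nat)
    (m : {sigma_finite_measure set (n.-tuple R) -> \bar R}) :
    set (n.+1.-tuple R) -> \bar R :=
  pushforward (@lebesgue_measure R \x m)%E (@tuple_cons R n).

Section cons_measure_measure.
Context (R : realType) (n : nat).
Variable m : {sigma_finite_measure set (n.-tuple R) -> \bar R}.

Let prodm : {measure set (measurableTypeR R * n.-tuple R) -> \bar R} :=
  (@lebesgue_measure R \x m)%E.

Let nu : {measure set (n.+1.-tuple R) -> \bar R} :=
  measure_function_pushforward__canonical__measure_function_Measure
    prodm (@measurable_tuple_cons R n).

HB.instance Definition _ := isMeasure.Build _ _ _ (cons_measure m)
  (measure0 nu) (measure_ge0 nu) (@measure_semi_sigma_additive _ _ _ nu).

End cons_measure_measure.

(** Boxes [F k] x [G k] are pulled back along the inverse of [tuple_cons]. Both exhaustions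
    increase, so a point with coordinates in [F i] and [G j] lies in the box of index [maxn i j]. *)
Lemma cons_measure_sigma_finite (R : realType) (n : nat)
    (m : {sigma_finite_measure set (n.-tuple R) -> \bar R}) :
  sigma_finite setT (@cons_measure R n m).
Proof.
have /sigma_finiteP[F [TF ndF Foo]] := sigma_finiteT (@lebesgue_measure R).
have /sigma_finiteP[G [TG ndG Goo]] := sigma_finiteT m.
pose uncons (x : n.+1.-tuple R) : measurableTypeR R * n.-tuple R :=
  (tnth x ord0, [tuple of behead x]).
have unconsK z : uncons (tuple_cons z) = z.
  by rewrite /uncons; case: z => a b; congr pair; apply: val_inj.
have muncons : measurable_fun setT uncons.
  apply: measurable_fun_pair; first exact: measurable_tnth.
  exact: measurable_behead.
exists (fun k => uncons @^-1` (F k `*` G k)).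
  apply/esym/seteqP; split => // x _.
  have : setT (uncons x).1 by []. rewrite TF => -[i _ Fi].
  have : setT (uncons x).2 by []. rewrite TG => -[j _ Gj].
  exists (maxn i j) => //; split.
    by move: Fi; apply/subsetPset/ndF/leq_maxl.
  by move: Gj; apply/subsetPset/ndG/leq_maxr.
move=> k; have [mF Fk] := Foo k; have [mG Gk] := Goo k.
split.
  by rewrite -[X in measurable X]setTI; apply: muncons => //; exact: measurableX.
rewrite /cons_measure /pushforward (_ : _ @^-1` _ = F k `*` G k).
  by rewrite product_measure1E// lte_mul_pinfty// ge0_fin_numE.
by apply/seteqP; split => z; rewrite /preimage /mkset (unconsK z).
Qed.

HB.instance Definition _ (R : realType) (n : nat)
    (m : {sigma_finite_measure set (n.-tuple R) -> \bar R}) :=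
  Measure_isSigmaFinite.Build _ _ _ (@cons_measure R n m)
  (cons_measure_sigma_finite m).

Lemma ge0_integral_cons_measure (R : realType) (n : nat)
    (m : {sigma_finite_measure set (n.-tuple R) -> \bar R})
    (f : n.+1.-tuple R -> \bar R) :
  measurable_fun [set: n.+1.-tuple R] f -> (forall x, 0 <= f x)%E ->
  (\int[cons_measure m]_x f x =
   \int[@lebesgue_measure R]_t \int[m]_x f [tuple of t :: x])%E.
Proof.
move=> mf f0.
rewrite /cons_measure ge0_integral_pushforward //; last exact: measurable_tuple_cons.
rewrite preimage_setT (fubini_tonelli1 (f \o (@tuple_cons R n))) //.
  by apply: measurableT_comp => //; exact: measurable_tuple_cons.
by move=> z; exact: f0.
Qed.

(** The recursion mirrors that of [integralRn], so that Tonelli identifies the two; sigma-finiteness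
    is carried along because Tonelli uses it at each stage. *)
Fixpoint lebesgue_tuple (R : realType) (n : nat) :
    {sigma_finite_measure set (n.-tuple R) -> \bar R} :=
  match n with
  | 0 => \d_([tuple] : 0.-tuple R)
  | n'.+1 => cons_measure (lebesgue_tuple R n')
  end.

Lemma measurable_tuple_cons1 (R : realType) (n : nat) (t : R) :
  measurable_fun [set: n.-tuple R] (fun x => [tuple of t :: x] : n.+1.-tuple R).
Proof.
by apply: (@measurable_cons _ _ (n.-tuple R) (measurableTypeR R) (cst t) n id).
Qed.

Lemma integralRnE (R : realType) (n : nat) (f : n.-tuple R -> \bar R) :
  measurable_fun [set: n.-tuple R] f -> (forall x, 0 <= f x)%E ->
  integralRn f = (\int[lebesgue_tuple R n]_x f x)%E.
Proof.
elim: n f => [|n IH] f mf f0 /=.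
  by rewrite integral_dirac// diracT mul1e.
rewrite ge0_integral_cons_measure //; apply: eq_integral => t _.
rewrite IH //; apply: measurableT_comp => //; exact: measurable_tuple_cons1.
Qed.

(** * Tensor products of bilinear bounds *)

Section integral_helpers.
Local Open Scope ereal_scope.
Context d (T : measurableType d) (R : realType).
Variable mu : {measure set T -> \bar R}.

(** Holds without measurability: the integral of a nonnegative function is a supremum over simple
    functions below it, and those below f are also below g. *)
Lemma ge0_le_integralT (f g : T -> \bar R) :
  (forall x, 0 <= f x) -> (forall x, f x <= g x) ->
  \int[mu]_x f x <= \int[mu]_x g x.
Proof.
move=> f0 fg; have g0 x : 0 <= g x by exact: le_trans (fg x).
rewrite !ge0_integralTE//; apply: le_ereal_sup => _ [h hf <-].
by exists h => // x; exact: le_trans (hf x) (fg x).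
Qed.

End integral_helpers.

Lemma measurable_uncurry_integral d1 d2 (T1 : measurableType d1)
    (T2 : measurableType d2) (R : realType)
    (m2 : {sigma_finite_measure set T2 -> \bar R}) (f : T1 -> T2 -> \bar R) :
  measurable_fun [set: T1 * T2] (fun z => f z.1 z.2) ->
  (forall x y, 0 <= f x y)%E ->
  measurable_fun [set: T1] (fun x => \int[m2]_y f x y)%E.
Proof.
move=> mf f0.
exact: (measurable_fun_fubini_tonelli_F (m2 := m2) (fun z : T1 * T2 => f z.1 z.2) mf).
Qed.

Lemma ge0_integral_swap d1 d2 (T1 : measurableType d1)
    (T2 : measurableType d2) (R : realType)
    (m1 : {sigma_finite_measure set T1 -> \bar R})
    (m2 : {sigma_finite_measure set T2 -> \bar R}) (f : T1 -> T2 -> \bar R) :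
  measurable_fun [set: T1 * T2] (fun z => f z.1 z.2) ->
  (forall x y, 0 <= f x y)%E ->
  (\int[m1]_x \int[m2]_y f x y = \int[m2]_y \int[m1]_x f x y)%E.
Proof.
move=> mf f0.
exact: (fubini_tonelli (m1 := m1) (m2 := m2) (fun z : T1 * T2 => f z.1 z.2) mf).
Qed.

Lemma ge0_integralZl2 d1 d2 (T1 : measurableType d1)
    (T2 : measurableType d2) (R : realType)
    (m1 : {sigma_finite_measure set T1 -> \bar R})
    (m2 : {sigma_finite_measure set T2 -> \bar R})
    (f : T1 -> T2 -> \bar R) (c : \bar R) :
  measurable_fun [set: T1 * T2] (fun z => f z.1 z.2) ->
  (forall x y, 0 <= f x y)%E -> (0 <= c)%E ->
  (\int[m1]_x \int[m2]_y (c * f x y) = c * \int[m1]_x \int[m2]_y f x y)%E.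
Proof.
move=> mf f0 c0.
rewrite -ge0_integralZl//; last 2 first.
- exact: measurable_uncurry_integral.
- by move=> x _; exact: integral_ge0.
apply: eq_integral => x _; rewrite ge0_integralZl//.
exact: (measurableT_comp mf (pair1_measurable x)).
Qed.

(** For phi = f^(1/s) and psi = g^(1/t) this bounds the form of K by the norms of f in L^(1/s) and g
    in L^(1/t). Written with plain integrals of phi and psi, it can be iterated over slices. *)
Definition bilinear_bound d (T : measurableType d) (R : realType)
    (mu : set T -> \bar R) (K : T -> T -> \bar R) (s t C : R) :=
  forall phi psi : T -> \bar R,
    measurable_fun setT phi -> (forall x, 0 <= phi x)%E ->
    measurable_fun setT psi -> (forall x, 0 <= psi x)%E ->
  (\int[mu]_x \int[mu]_y (phi x `^ s * psi y `^ t * K x y) <=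
   C%:E * ((\int[mu]_x phi x) `^ s * (\int[mu]_x psi x) `^ t))%E.

Fixpoint tensor_kernel (R : realType) (k : R -> R -> \bar R) (n : nat) :
    n.-tuple R -> n.-tuple R -> \bar R :=
  match n with
  | 0 => fun _ _ => 1%E
  | n'.+1 => fun x y => (k (tnth x ord0) (tnth y ord0) *
      tensor_kernel k [tuple of behead x] [tuple of behead y])%E
  end.

Section tensor.
Local Open Scope ereal_scope.
Context (R : realType) (k : R -> R -> \bar R).
Hypothesis mk : measurable_fun [set: measurableTypeR R * measurableTypeR R]
  (fun z => k z.1 z.2).
Hypothesis k0 : forall x y, 0 <= k x y.

Lemma tensor_kernel_ge0 n (x y : n.-tuple R) : 0 <= tensor_kernel k x y.
Proof. by elim: n x y => //= n IH x y; rewrite mule_ge0. Qed.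

Lemma tensor_kernel_cons n (t s : R) (x y : n.-tuple R) :
  tensor_kernel k [tuple of t :: x] [tuple of s :: y] =
  k t s * tensor_kernel k x y.
Proof.
by rewrite /= ; congr (_ * tensor_kernel k _ _); apply: val_inj.
Qed.

Lemma measurable_tensor_kernel n :
  measurable_fun [set: n.-tuple R * n.-tuple R]
    (fun z => tensor_kernel k z.1 z.2).
Proof.
elim: n => [|n IH] /=; first exact: measurable_cst.
pose h (z : n.+1.-tuple R * n.+1.-tuple R) :
    measurableTypeR R * measurableTypeR R :=
  (tnth z.1 ord0, tnth z.2 ord0).
pose g (z : n.+1.-tuple R * n.+1.-tuple R) : n.-tuple R * n.-tuple R :=
  ([tuple of behead z.1], [tuple of behead z.2]).
have mh : measurable_fun setT h.
  apply: measurable_fun_pair.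
    by apply: (measurableT_comp (measurable_tnth ord0)); exact: measurable_fst.
  by apply: (measurableT_comp (measurable_tnth ord0)); exact: measurable_snd.
have mg : measurable_fun setT g.
  apply: measurable_fun_pair.
    by apply: (measurableT_comp (@measurable_behead _ _ _)); exact: measurable_fst.
  by apply: (measurableT_comp (@measurable_behead _ _ _)); exact: measurable_snd.
exact: (emeasurable_funM (measurableT_comp mk mh) (measurableT_comp IH mg)).
Qed.

Lemma measurable_bilinear_integrand d (T : measurableType d)
    (K : T -> T -> \bar R) (phi psi : T -> \bar R) (s t : R) :
  measurable_fun [set: T * T] (fun z => K z.1 z.2) ->
  measurable_fun setT phi -> measurable_fun setT psi ->
  measurable_fun [set: T * T]
    (fun z => phi z.1 `^ s * psi z.2 `^ t * K z.1 z.2).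
Proof.
move=> mK mphi mpsi; apply: emeasurable_funM => //; apply: emeasurable_funM.
  apply: (measurableT_comp (measurable_poweR s)).
  exact: (measurableT_comp mphi measurable_fst).
apply: (measurableT_comp (measurable_poweR t)).
exact: (measurableT_comp mpsi measurable_snd).
Qed.

(** Induction on the dimension. With first coordinates a and b fixed, the bound in dimension n
    applies to the slices and leaves Phi(a)^s Psi(b)^t k(a, b); the one-dimensional bound then
    applies to Phi and Psi, whose integrals are those of phi and psi. *)
Lemma tensor_bilinear_bound n (s t C : R) : (0 <= C)%R ->
  bilinear_bound (@lebesgue_measure R) k s t C ->
  bilinear_bound (lebesgue_tuple R n) (@tensor_kernel R k n) s t (C ^+ n).
Proof.
move=> C0 kC; elim: n => [|n IH] phi psi mphi phi0 mpsi psi0.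
  have dE (f : 0.-tuple R -> \bar R) :
      \int[lebesgue_tuple R 0]_x f x = f [tuple].
    rewrite (eq_integral (cst (f [tuple]))); last by move=> x _; rewrite (tuple0 x).
    by rewrite integral_cst//= diracT mule1.
  by rewrite !dE /= expr0 mule1 mul1e.
pose F x y := phi x `^ s * psi y `^ t * tensor_kernel k x y.
have F0 x y : 0 <= F x y.
  by rewrite !mule_ge0// ?poweR_ge0// tensor_kernel_ge0.
have mF : measurable_fun setT (fun z => F z.1 z.2).
  exact: (measurable_bilinear_integrand s t (@measurable_tensor_kernel n.+1) mphi mpsi).
have mc : measurable_fun [set: measurableTypeR R * n.-tuple R]
    (fun z => [tuple of z.1 :: z.2] : n.+1.-tuple R).
  exact: measurable_tuple_cons.
pose Phi (a : measurableTypeR R) := \int[lebesgue_tuple R n]_x phi [tuple of a :: x].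
pose Psi (a : measurableTypeR R) := \int[lebesgue_tuple R n]_x psi [tuple of a :: x].
have mPhi : measurable_fun setT Phi.
  apply: measurable_uncurry_integral => //.
  exact: (measurableT_comp mphi mc).
have mPsi : measurable_fun setT Psi.
  apply: measurable_uncurry_integral => //.
  exact: (measurableT_comp mpsi mc).
have Phi0 a : 0 <= Phi a by exact: integral_ge0.
have Psi0 a : 0 <= Psi a by exact: integral_ge0.
have slice a b :
    \int[lebesgue_tuple R n]_x \int[lebesgue_tuple R n]_y
      F [tuple of a :: x] [tuple of b :: y] <=
    (C ^+ n)%:E * (Phi a `^ s * Psi b `^ t * k a b).
  under eq_integral do under eq_integral do
    rewrite /F tensor_kernel_cons muleCA.
  have mphia := measurableT_comp mphi (@measurable_tuple_cons1 R n a).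
  have mpsib := measurableT_comp mpsi (@measurable_tuple_cons1 R n b).
  rewrite ge0_integralZl2//; last 2 first.
  - exact: (measurable_bilinear_integrand s t (@measurable_tensor_kernel n) mphia mpsib).
  - by move=> x y; rewrite !mule_ge0// ?poweR_ge0// tensor_kernel_ge0.
  rewrite (muleC _ (k a b)) (muleCA _ (k a b)) lee_wpmul2l//.
  exact: (IH _ _ mphia (fun x => phi0 _) mpsib (fun x => psi0 _)).
have mF3 a : measurable_fun
    [set: (n.-tuple R * measurableTypeR R) * n.-tuple R]
    (fun z => F [tuple of a :: z.1.1] [tuple of z.1.2 :: z.2]).
  pose h1 (z : (n.-tuple R * measurableTypeR R) * n.-tuple R) :
     measurableTypeR R * n.-tuple R := (z.1.2, z.2).
  have mh1 : measurable_fun setT h1.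
    apply: measurable_fun_pair; last exact: measurable_snd.
    exact: (measurableT_comp measurable_snd measurable_fst).
  pose h2 (z : (n.-tuple R * measurableTypeR R) * n.-tuple R) :
     n.+1.-tuple R * n.+1.-tuple R :=
     ([tuple of a :: z.1.1], [tuple of z.1.2 :: z.2]).
  have mh2 : measurable_fun setT h2.
    apply: measurable_fun_pair; last exact: (measurableT_comp mc mh1).
    apply: (measurableT_comp (@measurable_tuple_cons1 R n a)).
    exact: (measurableT_comp measurable_fst measurable_fst).
  exact: (measurableT_comp mF mh2).
rewrite ge0_integral_cons_measure; last 2 first.
- exact: (@measurable_uncurry_integral _ _ _ _ _ (lebesgue_tuple R n.+1) _ mF F0).
- by move=> x; apply: integral_ge0 => ? _; exact: F0.
rewrite (_ : \int[cons_measure (lebesgue_tuple R n)]_x phi x =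
    \int[lebesgue_measure]_a Phi a); last first.
  by rewrite ge0_integral_cons_measure.
rewrite (_ : \int[cons_measure (lebesgue_tuple R n)]_x psi x =
    \int[lebesgue_measure]_a Psi a); last first.
  by rewrite ge0_integral_cons_measure.
pose H (a b : measurableTypeR R) := Phi a `^ s * Psi b `^ t * k a b.
apply: (@le_trans _ _ (\int[lebesgue_measure]_a \int[lebesgue_measure]_b
  ((C ^+ n)%:E * H a b))).
  apply: ge0_le_integralT => a; first by do 2! apply: integral_ge0 => ? _; exact: F0.
  (* For fixed a, the integral over the second tuple splits into b and y; moving b in front of x
     exposes the integral that [slice] bounds. *)
  rewrite (_ : \int[_]_x _ = \int[lebesgue_measure]_b \int[lebesgue_tuple R n]_x
     \int[lebesgue_tuple R n]_y F [tuple of a :: x] [tuple of b :: y]).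
    apply: ge0_le_integralT => b; last exact: slice.
    by do 2! apply: integral_ge0 => ? _; exact: F0.
  pose G (x : n.-tuple R) (b : measurableTypeR R) := \int[lebesgue_tuple R n]_y
    F [tuple of a :: x] [tuple of b :: y].
  have G0 x b : 0 <= G x b by apply: integral_ge0 => ? _; exact: F0.
  have mG : measurable_fun setT (fun z => G z.1 z.2).
    exact: (@measurable_uncurry_integral _ _ _ _ _ (lebesgue_tuple R n)
      (fun (w : n.-tuple R * measurableTypeR R) y =>
        F [tuple of a :: w.1] [tuple of w.2 :: y]) (mF3 a)
      (fun w y => F0 _ _)).
  rewrite -(@ge0_integral_swap _ _ _ _ _ (lebesgue_tuple R n)
    (@lebesgue_measure R) G mG G0).
  apply: eq_integral => x _; rewrite ge0_integral_cons_measure//.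
    exact: (measurableT_comp mF (pair1_measurable _)).
  by move=> y; exact: F0.
have -> : \int[lebesgue_measure]_a \int[lebesgue_measure]_b ((C ^+ n)%:E * H a b) =
    (C ^+ n)%:E * \int[lebesgue_measure]_a \int[lebesgue_measure]_b H a b.
  apply: ge0_integralZl2.
  - exact: (measurable_bilinear_integrand s t mk mPhi mPsi).
  - by move=> a b; rewrite !mule_ge0// ?poweR_ge0.
  - by rewrite lee_fin exprn_ge0.
rewrite exprSr EFinM -muleA lee_wpmul2l ?lee_fin ?exprn_ge0//.
exact: kC.
Qed.

End tensor.

(** * The one-dimensional Hardy-Littlewood-Sobolev inequality *)

(** D is the sum over k of r_k^(-e) on the ball of radius 2 r_k, where r_k = rho b^k. Each ball has
    measure 4 r_k, so the integrals form a geometric series of ratio b^(1 - e). The choice b = 1/2,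
    e < 1 treats a neighbourhood of y, and b = 2, e > 1 its complement. *)
Lemma dyadic_majorant (R : realType) (b e rho y : R) :
  0 < b -> 0 <= e -> b `^ (1 - e) < 1 -> 0 < rho ->
  exists D : measurableTypeR R -> \bar R, [/\ measurable_fun setT D,
    forall x, (0 <= D x)%E,
    (\int[@lebesgue_measure R]_x D x <=
      (4 / (1 - b `^ (1 - e)) * rho `^ (1 - e))%:E)%E &
    forall x k, rho * b ^+ k <= `|x - y| < 2 * (rho * b ^+ k) ->
      ((`|x - y| `^ (- e))%:E <= D x)%E].
Proof.
move=> b0 e0 w1 rho0; set w := b `^ (1 - e).
have w0 : 0 < w by rewrite powR_gt0.
pose r k := rho * b ^+ k.
have r0 k : 0 < r k by rewrite mulr_gt0// exprn_gt0.
pose B k : set (measurableTypeR R) := ball y (2 * r k).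
have mB k : measurable (B k) by exact: measurable_ball.
pose g k (x : measurableTypeR R) : \bar R := ((r k `^ (- e))%:E * (\1_(B k) x)%:E)%E.
have g0 k x : (0 <= g k x)%E by rewrite mule_ge0// lee_fin ?powR_ge0.
have mg k : measurable_fun setT (g k).
  by apply: measurable_funeM; apply/measurable_EFinP; exact: measurable_indic.
exists (fun x => \sum_(k <oo) g k x)%E; split.
- by apply: ge0_emeasurable_sum => //.
- by move=> x; apply: nneseries_ge0.
- rewrite integral_nneseries//; apply: lime_le.
    by apply: is_cvg_nneseries => k _ _; exact: integral_ge0.
  apply: nearW => n.
  have gE k : (\int[@lebesgue_measure R]_x g k x = (4 * rho `^ (1 - e) * w ^+ k)%:E)%E.
    rewrite ge0_integralZl//; last 2 first.
    - by apply/measurable_EFinP; exact: measurable_indic.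
    - by rewrite lee_fin powR_ge0.
    rewrite integral_indic// setIT.
    transitivity ((r k `^ (- e))%:E * ((2 * r k) *+ 2)%:E)%E.
      congr (_ * _)%E; apply: lebesgue_measure_ball.
      by rewrite mulr_ge0 ?(ltW (r0 k)).
    rewrite -EFinM; congr EFin.
    have E1 : r k `^ (1 - e) = r k * r k `^ (- e).
      rewrite powRD ?powRr1 ?(ltW (r0 k))//.
      by apply/implyP => _; rewrite gt_eqF// r0.
    have E2 : r k `^ (1 - e) = rho `^ (1 - e) * w ^+ k.
      rewrite /r powRM ?(ltW rho0) ?exprn_ge0 ?(ltW b0)//.
      by rewrite -(powR_mulrn k (ltW b0)) -powRrM (mulrC k%:R) powRrM powR_mulrn ?(ltW w0).
    by rewrite -mulrA -E2 E1; ring.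
  rewrite (eq_bigr (fun k => (geometric (4 * rho `^ (1 - e)) w k)%:E)); last first.
    by move=> k _; rewrite gE.
  rewrite sumEFin lee_fin (le_trans (geometric_le_lim n _ w0 _))//.
  + by rewrite mulr_ge0// powR_ge0.
  + by rewrite gtr0_norm.
  + by rewrite mulrAC.
- move=> x k /andP[xk kx].
  apply: (@le_trans _ _ (g k x)).
    rewrite /g indicE mem_set; last first.
      by rewrite /B -ball_normE /= distrC.
    rewrite mule1 lee_fin !powRN lef_pV2 ?posrE ?powR_gt0//; last first.
      exact: lt_le_trans (r0 k) xk.
    by apply: ge0_ler_powR => //; rewrite nnegrE ?(ltW (r0 k)).
  apply: (le_trans _ (@nneseries_lim_ge _ (g ^~ x) xpredT 0 k.+1 _)) => //.
  by rewrite big_nat_recr//= leeDr// sume_ge0.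
Qed.

Lemma exists_pow2_ge (R : realType) (c : R) : exists k, c <= 2 ^+ k.
Proof.
exists (Num.truncn c).+1; apply: (le_trans (ltW (truncnS_gt c))).
by rewrite -natrX ler_nat ltnW// ltn_expl.
Qed.

(** The shells start at rho / 2 so that together they fill 0 < z < rho; k is the least index whose
    inner radius does not exceed z. *)
Lemma dyadic_near (R : realType) (rho z : R) : 0 < z -> z < rho ->
  exists k, rho / 2 * 2^-1 ^+ k <= z < 2 * (rho / 2 * 2^-1 ^+ k).
Proof.
move=> z0 zrho.
have ex : exists k, rho / 2 * 2^-1 ^+ k <= z.
  have [k hk] := exists_pow2_ge (rho / 2 / z); exists k.
  rewrite exprVn ler_pdivrMr ?exprn_gt0// -ler_pdivrMl//.
  by rewrite mulrC.
case: (ex_minnP ex) => k hk kmin.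
exists k; rewrite hk/=; case: k hk kmin => [|k] hk kmin.
  by rewrite expr0 mulr1 mulrC divfK.
rewrite ltNge; apply/negP => h.
have : (k.+1 <= k)%N; last by rewrite ltnn.
apply: kmin; move: h; rewrite exprS; apply: le_trans.
by rewrite le_eqVlt; apply/orP; left; apply/eqP; field.
Qed.

Lemma dyadic_far (R : realType) (rho z : R) : 0 < rho -> rho <= z ->
  exists k, rho * 2 ^+ k <= z < 2 * (rho * 2 ^+ k).
Proof.
move=> rho0 rhoz.
have ex : exists k, z < 2 * (rho * 2 ^+ k).
  have [k hk] := exists_pow2_ge (z / rho); exists k.
  apply: (@le_lt_trans _ _ (rho * 2 ^+ k)); first by rewrite mulrC -ler_pdivrMr.
  by rewrite ltr_pMl ?ltr1n// mulr_gt0// exprn_gt0.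
case: (ex_minnP ex) => k hk kmin.
exists k; rewrite hk andbT; case: k hk kmin => [|k] hk kmin.
  by rewrite expr0 mulr1.
rewrite leNgt; apply/negP => h.
have : (k.+1 <= k)%N; last by rewrite ltnn.
by apply: kmin; move: h; rewrite exprS mulrCA.
Qed.

Lemma powR_young (R : realType) (a b t : R) : 0 <= a -> 0 <= b -> 0 < t < 1 ->
  a `^ t * b `^ (1 - t) <= a + b.
Proof.
move=> a0 b0 /andP[t0 t1].
have self (c : R) : 0 <= c -> c `^ t * c `^ (1 - t) = c.
  move=> c0; rewrite -powRD; first by rewrite subrKC powRr1.
  by rewrite subrKC oner_eq0.
have [ab|ba] := leP a b.
  apply: (@le_trans _ _ b); last by rewrite lerDr.
  rewrite -[leRHS](self _ b0) ler_wpM2r ?powR_ge0//.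
  by rewrite ge0_ler_powR ?nnegrE ?(ltW t0).
apply: (@le_trans _ _ a); last by rewrite lerDl.
rewrite -[leRHS](self _ a0) ler_wpM2l ?powR_ge0//.
by rewrite ge0_ler_powR ?nnegrE ?subr_ge0 ?(ltW t1) ?(ltW ba).
Qed.

(* The value +oo on the diagonal makes products of one-dimensional kernels
   dominate the Riesz kernel everywhere, not just off the coordinate planes. *)
Definition kernel1 (R : realType) (lam x y : R) : \bar R :=
  if x == y then +oo%E else (`|x - y| `^ (- lam))%:E.

Lemma kernel1_ge0 (R : realType) (lam x y : R) : (0 <= kernel1 lam x y)%E.
Proof. by rewrite /kernel1; case: ifP => // _; rewrite lee_fin powR_ge0. Qed.

Lemma kernel1C (R : realType) (lam x y : R) : kernel1 lam x y = kernel1 lam y x.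
Proof. by rewrite /kernel1 eq_sym distrC. Qed.

Lemma measurable_kernel1 (R : realType) (lam : R) :
  measurable_fun [set: measurableTypeR R * measurableTypeR R]
    (fun z => kernel1 lam z.1 z.2).
Proof.
apply: measurable_fun_ifT.
- apply: (@measurable_fun_eqr _ _ R setT (fun z => z.1) (fun z => z.2)).
    exact: measurable_fst.
  exact: measurable_snd.
- exact: measurable_cst.
- apply/measurable_EFinP; apply: (measurableT_comp (measurable_powR (- lam))).
  apply: (measurableT_comp (@normr_measurable _ _)).
  by apply: measurable_funB; [exact: measurable_fst|exact: measurable_snd].
Qed.

(* Near the diagonal the truncation bounds the integrand by L^s |x-y|^-lam,
   away from it Young's inequality separates phi from the kernel; the radius
   1/L balances the two contributions. *)
Lemma truncated_kernel1_bound (R : realType) (lam s t : R) :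
  0 < s < 1 -> 0 < t < 1 -> 0 < lam < 1 -> s + t + lam = 2 ->
  exists2 C : R, 0 < C &
  forall phi : measurableTypeR R -> \bar R,
    measurable_fun setT phi -> (forall x, 0 <= phi x)%E ->
    (\int[@lebesgue_measure R]_x phi x <= 1)%E ->
  forall L y : R, 0 < L ->
  (\int[@lebesgue_measure R]_x ((mine (phi x) L%:E) `^ s * kernel1 lam x y) <=
   (C * L `^ (1 - t))%:E)%E.
Proof.
move=> /andP[s0 s1] /andP[t0 t1] /andP[lam0 lam1] stl.
(* Young's inequality with weights s and 1 - s turns phi^s |x-y|^(-lam) into phi and |x-y|^(-kap).
   Since lam = (1 - s) + (1 - t), kap exceeds 1 and the second term is integrable away from the
   diagonal. *)
pose kap := lam / (1 - s).
have s1' : 0 < 1 - s by rewrite subr_gt0.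
have kap1 : 1 < kap by rewrite ltr_pdivlMr//; lra.
have kapE : kap * (1 - s) = lam by rewrite divfK// gt_eqF.
pose tau := s / (1 - s).
have tauE : tau * (1 - s) = s by rewrite divfK// gt_eqF.
have w1 : (2^-1 : R) `^ (1 - lam) < 1.
  by rewrite -[ltRHS](congr1 (@^~ (1 - lam)) (@powR1 R)) gt0_ltr_powR ?nnegrE ?subr_gt0//; lra.
have w2 : (2 : R) `^ (1 - kap) < 1.
  rewrite -opprB powRN invf_lt1 ?powR_gt0//.
  by rewrite -[ltLHS](congr1 (@^~ (kap - 1)) (@powR1 R)) gt0_ltr_powR ?nnegrE ?subr_gt0//; lra.
set c1 := 4 / (1 - (2^-1 : R) `^ (1 - lam)).
set c2 := 4 / (1 - (2 : R) `^ (1 - kap)).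
have c10 : 0 <= c1 by rewrite divr_ge0// subr_ge0 ltW.
have c20 : 0 <= c2 by rewrite divr_ge0// subr_ge0 ltW.
exists (c1 * (2^-1 : R) `^ (1 - lam) + 1 + c2).
  by rewrite ltr_pwDl// ltr_pwDr// mulr_ge0// powR_ge0.
move=> phi mphi phi0 phi1 L y L0.
have iL0 : 0 < L^-1 by rewrite invr_gt0.
have [D1 [mD1 D10 iD1 hD1]] := @dyadic_majorant R 2^-1 lam (L^-1 / 2) y
  ltac:(by lra) (ltW lam0) w1 ltac:(by rewrite divr_gt0).
have [D2 [mD2 D20 iD2 hD2]] := @dyadic_majorant R 2 kap L^-1 y
  ltac:(by lra) ltac:(by lra) w2 iL0.
(* The weight of phi in Young's inequality; the kernel gets the weight m^(-tau), as m^s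
   (m^(-tau))^(1 - s) = 1. The value is the bound aimed at, since phi has integral at most 1. *)
have [m mE] : exists m, m = L `^ (1 - t) by eexists.
have m0 : 0 < m by rewrite mE powR_gt0.
pose G x := ((L `^ s)%:E * D1 x + (m%:E * phi x + (m `^ (- tau))%:E * D2 x))%E.
have pointwise x : x != y ->
  ((mine (phi x) L%:E) `^ s * kernel1 lam x y <= G x)%E.
  move=> xy; rewrite /kernel1 (negbTE xy).
  have z0 : 0 < `|x - y| by rewrite normr_gt0 subr_eq0.
  set z := `|x - y| in z0 *.
  have [a [aE a0 aL aphi]] : exists a : R, [/\ mine (phi x) L%:E = a%:E,
      0 <= a, a <= L & (a%:E <= phi x)%E].
    case: (phi x) (phi0 x) => [r r0|_|//].
    - exists (Num.min r L); rewrite EFin_min; split=> //.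
      + by rewrite le_min (ltW L0) andbT -lee_fin.
      + by rewrite ge_min lexx orbT.
      + by rewrite -EFin_min lee_fin ge_min lexx.
    - by exists L; rewrite (ltW L0) lexx leey /mine ltNge leey.
  rewrite aE poweR_EFin -EFinM.
  have [zL|zL] := ltP z L^-1.
    have [k zk] := dyadic_near z0 zL.
    rewrite /G; apply: (@le_trans _ _ ((L `^ s)%:E * D1 x)%E); last first.
      by rewrite leeDl// adde_ge0// mule_ge0// lee_fin ?powR_ge0// ltW.
    rewrite EFinM lee_pmul ?lee_fin ?powR_ge0//.
      by rewrite ge0_ler_powR ?nnegrE ?(ltW s0) ?(ltW L0).
    exact: hD1 zk.
  have [k zk] := dyadic_far iL0 zL.
  rewrite /G; apply: (@le_trans _ _ (m%:E * phi x + (m `^ (- tau))%:E * D2 x)%E); last first.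
    by rewrite leeDr// mule_ge0// lee_fin powR_ge0.
  apply: (@le_trans _ _ (m * a + m `^ (- tau) * z `^ (- kap))%:E).
    rewrite lee_fin; apply: le_trans (powR_young (t := s) _ _ _); last 3 first.
    - by rewrite mulr_ge0// ltW.
    - by rewrite mulr_ge0// powR_ge0.
    - by rewrite s0.
    rewrite !powRM ?powR_ge0 ?(ltW m0)// -!powRrM !mulNr tauE kapE.
    rewrite mulrACA -powRD ?subrr ?powRr0 ?mul1r//.
    by apply/implyP => _; rewrite gt_eqF.
  rewrite EFinD !EFinM leeD// lee_wpmul2l ?lee_fin ?powR_ge0 ?(ltW m0)//.
  exact: hD2 zk.
have G0 x : (0 <= G x)%E.
  by rewrite !adde_ge0// mule_ge0// lee_fin ?powR_ge0// ltW.
pose f x := ((mine (phi x) L%:E) `^ s * kernel1 lam x y)%E.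
have mf : measurable_fun [set: measurableTypeR R] f.
  apply: emeasurable_funM.
    apply: (measurableT_comp (measurable_poweR s)).
    exact: measurable_mine.
  exact: (measurableT_comp (measurable_kernel1 lam) (pair2_measurable y)).
have f0 x : (0 <= f x)%E by rewrite mule_ge0 ?poweR_ge0// kernel1_ge0.
(* The point x = y, where the kernel is infinite, is a null set and is removed. *)
rewrite -/f; have -> : (\int[@lebesgue_measure R]_x f x =
    \int[@lebesgue_measure R]_x (f \_ (setT `\ y)) x)%E.
  rewrite -(@integral_setD1 R f y setT); last 2 first.
  - exact: measurableD.
  - exact: measurable_funTS.
  by rewrite integral_mkcond.
apply: (@le_trans _ _ (\int[@lebesgue_measure R]_x G x)%E).
  apply: ge0_le_integralT => x; rewrite patchE; case: ifPn => //.
  by rewrite inE /= => -[_ /eqP xy]; exact: pointwise.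
rewrite ge0_integralD//; last 4 first.
- by move=> x _; rewrite mule_ge0// lee_fin powR_ge0.
- exact: measurable_funeM.
- by move=> x _; rewrite !adde_ge0// mule_ge0// lee_fin ?powR_ge0// ltW.
- by apply: emeasurable_funD; exact: measurable_funeM.
rewrite ge0_integralD//; last 4 first.
- by move=> x _; rewrite mule_ge0// lee_fin ltW.
- exact: measurable_funeM.
- by move=> x _; rewrite mule_ge0// lee_fin powR_ge0.
- exact: measurable_funeM.
rewrite !ge0_integralZl// ?lee_fin ?powR_ge0 ?(ltW m0)//.
(* Each of the three terms scales as L^(1 - t): the near one because s - (1 - lam) = 1 - t, the
   middle one by the choice of m, the far one because -(1 - t) tau - (1 - kap) = 1 - t. *)
rewrite !mulrDl mul1r -addrA !EFinD; apply: leeD.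
  apply: (@le_trans _ _ ((L `^ s)%:E * (c1 * (L^-1 / 2) `^ (1 - lam))%:E)%E).
    by rewrite lee_wpmul2l// lee_fin powR_ge0.
  rewrite -EFinM lee_fin powRM ?(ltW iL0)//.
  rewrite -powR_inv1 ?(ltW L0)// -powRrM.
  have -> : 1 - t = s + (-1) * (1 - lam) by lra.
  rewrite (@powRD _ L); last by apply/implyP => _; rewrite gt_eqF.
  by rewrite le_eqVlt; apply/orP; left; apply/eqP; ring.
apply: leeD.
  by rewrite -mE -[leRHS]mule1 lee_wpmul2l// lee_fin ltW.
apply: (@le_trans _ _ ((m `^ (- tau))%:E * (c2 * L^-1 `^ (1 - kap))%:E)%E).
  by rewrite lee_wpmul2l// lee_fin powR_ge0.
rewrite -EFinM lee_fin mulrCA ler_wpM2l//.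
rewrite mE -powR_inv1 ?(ltW L0)// -!powRrM -powRD; last by apply/implyP => _; rewrite gt_eqF.
have -> // : (1 - t) * - tau + -1 * (1 - kap) = 1 - t.
have lamE : lam = 2 - s - t by lra.
by rewrite /tau /kap lamE; field; rewrite gt_eqF.
Qed.

(** Both sides are homogeneous of degree s in phi and t in psi, which allows division by the
    integrals. If one integral vanishes, its function is zero almost everywhere and so is the left
    side; if both are positive and one is infinite, so is the right side. *)
Lemma bilinear_bound_normalized d (T : measurableType d) (R : realType)
    (mu : {sigma_finite_measure set T -> \bar R}) (K : T -> T -> \bar R)
    (s t C : R) :
  measurable_fun [set: T * T] (fun z => K z.1 z.2) ->
  (forall x y, 0 <= K x y)%E -> 0 < s -> 0 < t -> 0 < C ->
  (forall phi psi : T -> \bar R,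
    measurable_fun setT phi -> (forall x, 0 <= phi x)%E ->
    (\int[mu]_x phi x <= 1)%E ->
    measurable_fun setT psi -> (forall x, 0 <= psi x)%E ->
    (\int[mu]_x psi x <= 1)%E ->
    (\int[mu]_x \int[mu]_y (phi x `^ s * psi y `^ t * K x y) <= C%:E)%E) ->
  bilinear_bound mu K s t C.
Proof.
move=> mK K0 s0 t0 C0 hC phi psi mphi phi0 mpsi psi0.
pose F x y := (phi x `^ s * psi y `^ t * K x y)%E.
have mF := measurable_bilinear_integrand s t mK mphi mpsi.
have F0 x y : (0 <= F x y)%E by rewrite !mule_ge0// poweR_ge0.
have mF1 : measurable_fun setT (fun x => \int[mu]_y F x y)%E.
  exact: (@measurable_uncurry_integral _ _ _ _ _ mu F).
have mF2 : measurable_fun setT (fun y => \int[mu]_x F x y)%E.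
  apply: (@measurable_uncurry_integral _ _ _ _ _ mu (fun y x => F x y)) => //.
  exact: (measurableT_comp mF (@measurable_swap _ _ _ _)).
have A0 : (0 <= \int[mu]_x phi x)%E by exact: integral_ge0.
have B0 : (0 <= \int[mu]_x psi x)%E by exact: integral_ge0.
have ae0 (f : T -> \bar R) : measurable_fun setT f -> (forall x, 0 <= f x)%E ->
    (\int[mu]_x f x = 0)%E -> ae_eq mu setT f (cst 0%E).
  move=> mf f0 if0; apply/(ae_eq_integral_abs mu measurableT mf).
  by under eq_integral do rewrite gee0_abs//.
have [A00|A1] := eqVneq (\int[mu]_x phi x)%E 0%E.
  rewrite (_ : \int[mu]_x _ = 0)%E; first by rewrite A00 poweR0r ?gt_eqF// mul0e mule0.
  rewrite (@ge0_ae_eq_integral _ _ _ mu setT _ (cst 0%E))//.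
  - by rewrite integral0.
  - by move=> x _; apply: integral_ge0 => y _; exact: F0.
  apply: filterS (ae0 _ mphi phi0 A00) => x /(_ I) /= -> _.
  under eq_integral do rewrite poweR0r ?gt_eqF// !mul0e.
  by rewrite integral0.
have [B00|B1] := eqVneq (\int[mu]_x psi x)%E 0%E.
  rewrite (@ge0_integral_swap _ _ _ _ _ mu mu F)//.
  rewrite (_ : \int[mu]_y _ = 0)%E; first by rewrite B00 (@poweR0r _ t) ?gt_eqF// !mule0.
  rewrite (@ge0_ae_eq_integral _ _ _ mu setT _ (cst 0%E))//.
  - by rewrite integral0.
  - by move=> x _; apply: integral_ge0 => y _; exact: F0.
  apply: filterS (ae0 _ mpsi psi0 B00) => x /(_ I) /= E _; rewrite /F E.
  under eq_integral do rewrite (@poweR0r _ t) ?gt_eqF// mule0 mul0e.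
  by rewrite integral0.
have {}A0 : (0 < \int[mu]_x phi x)%E by rewrite lt0e A1.
have {}B0 : (0 < \int[mu]_x psi x)%E by rewrite lt0e B1.
have [Aoo|Afin] := eqVneq (\int[mu]_x phi x)%E +oo%E.
  by rewrite Aoo poweRyr ?gt_eqF// gt0_mulye ?poweR_gt0// gt0_muley ?lte_fin// leey.
have [Boo|Bfin] := eqVneq (\int[mu]_x psi x)%E +oo%E.
  by rewrite Boo poweRyr ?gt_eqF// gt0_muley ?poweR_gt0// gt0_muley ?lte_fin// leey.
have [a [aE a0]] : exists a : R, (\int[mu]_x phi x = a%:E)%E /\ 0 < a.
  case: (\int[mu]_x phi x)%E A0 Afin => [a|//|//] a0 _.
  by exists a; rewrite -lte_fin.
have [b [bE b0]] : exists a : R, (\int[mu]_x psi x = a%:E)%E /\ 0 < a.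
  case: (\int[mu]_x psi x)%E B0 Bfin => [b|//|//] b0 _.
  by exists b; rewrite -lte_fin.
have ia0 : 0 <= a^-1 by rewrite invr_ge0 ltW.
have ib0 : 0 <= b^-1 by rewrite invr_ge0 ltW.
have := hC (fun x => a^-1%:E * phi x)%E (fun x => b^-1%:E * psi x)%E.
rewrite !ge0_integralZl// aE bE -!EFinM !mulVf ?gt_eqF//.
have -> : (\int[mu]_x \int[mu]_y ((a^-1%:E * phi x) `^ s *
    (b^-1%:E * psi y) `^ t * K x y) =
    (a^-1 `^ s * b^-1 `^ t)%:E * \int[mu]_x \int[mu]_y F x y)%E.
  rewrite -(@ge0_integralZl2 _ _ _ _ _ mu mu F)//; last first.
    by rewrite lee_fin mulr_ge0// powR_ge0.
  apply: eq_integral => x _; apply: eq_integral => y _.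
  rewrite !poweRM ?lee_fin// !poweR_EFin EFinM /F.
  by rewrite muleACA !muleA.
move=> H.
have {}H : ((a^-1 `^ s * b^-1 `^ t)%:E * \int[mu]_x \int[mu]_y F x y <= C%:E)%E.
  apply: H => //; first exact: measurable_funeM.
  - by move=> x; rewrite mule_ge0// lee_fin.
  - exact: measurable_funeM.
  - by move=> x; rewrite mule_ge0// lee_fin.
rewrite mulrC EFinM -[leLHS]mul1e.
have -> : (1 = (a `^ s * b `^ t)%:E * (a^-1 `^ s * b^-1 `^ t)%:E)%E.
  rewrite -EFinM mulrACA -!powRM ?(ltW a0) ?(ltW b0)// !mulfV ?gt_eqF//.
  by rewrite powR1 mulr1.
by rewrite -muleA lee_wpmul2l// lee_fin mulr_ge0// powR_ge0.
Qed.

(* Splitting according to the smaller of phi x and psi y, either half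
   integrates to at most a constant times the integral of the larger one. *)
Lemma bilinear_bound_kernel1 (R : realType) (lam s t : R) :
  0 < s < 1 -> 0 < t < 1 -> 0 < lam < 1 -> s + t + lam = 2 ->
  exists2 C : R, 0 < C &
    bilinear_bound (@lebesgue_measure R) (@kernel1 R lam) s t C.
Proof.
move=> hs ht hlam stl.
have [C1 C10 hC1] := truncated_kernel1_bound hs ht hlam stl.
have [C2 C20 hC2] := truncated_kernel1_bound ht hs hlam
  (etrans (congr1 (+%R^~ lam) (addrC t s)) stl).
move: hs ht => /andP[s0 s1] /andP[t0 t1].
pose leb : {sigma_finite_measure set (measurableTypeR R) -> \bar R} :=
  @lebesgue_measure R.
pose H (u w : R) (phi psi : measurableTypeR R -> \bar R)
    (x y : measurableTypeR R) :=
  ((mine (phi x) (psi y)) `^ u * psi y `^ w * kernel1 lam x y)%E.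
have H0 u w phi psi x y : (0 <= H u w phi psi x y)%E.
  by rewrite !mule_ge0 ?poweR_ge0// kernel1_ge0.
have mH u w phi psi : measurable_fun setT phi -> measurable_fun setT psi ->
    measurable_fun [set: measurableTypeR R * measurableTypeR R]
      (fun z => H u w phi psi z.1 z.2).
  move=> mphi mpsi.
  have mphi1 := measurableT_comp mphi
    (@measurable_fst _ _ (measurableTypeR R) (measurableTypeR R)).
  have mpsi2 := measurableT_comp mpsi
    (@measurable_snd _ _ (measurableTypeR R) (measurableTypeR R)).
  apply: emeasurable_funM; last exact: measurable_kernel1.
  apply: emeasurable_funM.
    by apply: (measurableT_comp (measurable_poweR u)); exact: measurable_mine.
  exact: (measurableT_comp (measurable_poweR w) mpsi2).
(* With the truncation level L = psi y, the inner integral is at most psi^w C psi^(1 - w) = C psi,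
   and psi has integral at most 1. The values 0 and +oo of psi y are treated separately, because L
   is a positive real. *)
have half (u w C : R) : 0 < w -> 0 < C ->
    (forall phi : measurableTypeR R -> \bar R,
      measurable_fun setT phi -> (forall x, 0 <= phi x)%E ->
      (\int[leb]_x phi x <= 1)%E ->
      forall L y : R, 0 < L ->
      (\int[leb]_x ((mine (phi x) L%:E) `^ u * kernel1 lam x y) <=
       (C * L `^ (1 - w))%:E)%E) ->
    forall phi psi : measurableTypeR R -> \bar R,
      measurable_fun setT phi -> (forall x, 0 <= phi x)%E ->
      (\int[leb]_x phi x <= 1)%E ->
      measurable_fun setT psi -> (forall x, 0 <= psi x)%E ->
      (\int[leb]_x psi x <= 1)%E ->
    (\int[leb]_y \int[leb]_x H u w phi psi x y <= C%:E)%E.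
  move=> w0 C0 hC phi psi mphi phi0 phi1 mpsi psi0 psi1.
  apply: (@le_trans _ _ (\int[leb]_y (C%:E * psi y))%E); last first.
    rewrite ge0_integralZl ?lee_fin ?(ltW C0)//.
    by rewrite -[leRHS]mule1 lee_wpmul2l// lee_fin ltW.
  apply: ge0_le_integralT => y; first by apply: integral_ge0 => x _; exact: H0.
  rewrite /H; case: (psi y) (psi0 y) => [r|_|//]; last first.
    by rewrite gt0_muley ?lte_fin// leey.
  rewrite lee_fin le_eqVlt => /predU1P[<-|r0].
    rewrite mule0; under eq_integral do
      rewrite (@poweR0r _ w) ?gt_eqF// mule0 mul0e.
    by rewrite integral0.
  under eq_integral do rewrite (muleC (_ `^ u)%E) -muleA.
  rewrite ge0_integralZl//; last 3 first.
  - apply: emeasurable_funM.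
      apply: (measurableT_comp (measurable_poweR u)).
      exact: measurable_mine.
    exact: (measurableT_comp (measurable_kernel1 lam) (pair2_measurable y)).
  - by move=> x _; rewrite mule_ge0 ?poweR_ge0 ?kernel1_ge0.
  - exact: poweR_ge0.
  apply: (@le_trans _ _ ((r `^ w)%:E * (C * r `^ (1 - w))%:E)%E).
    by rewrite poweR_EFin lee_wpmul2l ?lee_fin ?powR_ge0// hC.
  rewrite -!EFinM lee_fin mulrCA -powRD; last first.
    by apply/implyP => _; rewrite gt_eqF.
  by rewrite addrC subrK powRr1// ltW.
exists (C1 + C2); first exact: addr_gt0.
apply: (@bilinear_bound_normalized _ _ _ leb) => //.
- exact: measurable_kernel1.
- exact: kernel1_ge0.
- exact: addr_gt0.
move=> phi psi mphi phi0 phi1 mpsi psi0 psi1.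
have mHC : measurable_fun [set: measurableTypeR R * measurableTypeR R]
    (fun z => H t s psi phi z.2 z.1).
  exact: (measurableT_comp (mH t s psi phi mpsi mphi) (@measurable_swap _ _ _ _)).
apply: (@le_trans _ _ (\int[leb]_x \int[leb]_y
    (H s t phi psi x y + H t s psi phi y x))%E).
  apply: ge0_le_integralT => x.
    by apply: integral_ge0 => y _; rewrite !mule_ge0 ?poweR_ge0// kernel1_ge0.
  apply: ge0_le_integralT => y.
    by rewrite !mule_ge0 ?poweR_ge0// kernel1_ge0.
  (* The smaller of the two values coincides with the minimum, so the integrand equals one of the
     two H terms; the second case uses the symmetry of the kernel. *)
  have [xy|/ltW yx] := leP (phi x) (psi y).
    by rewrite (_ : _ * _ = H s t phi psi x y)%E ?leeDl// /H /mine; case: ltgtP xy => // ->.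
  rewrite (_ : _ * _ = H t s psi phi y x)%E ?leeDr// /H kernel1C (muleC (phi x `^ s)%E).
  by rewrite /mine; case: ltgtP yx => // ->.
rewrite EFinD (_ : (\int[leb]_x _ = \int[leb]_x (\int[leb]_y H s t phi psi x y +
    \int[leb]_y H t s psi phi y x))%E); last first.
  apply: eq_integral => x _; rewrite ge0_integralD//.
  - exact: (measurableT_comp (mH s t phi psi mphi mpsi) (pair1_measurable x)).
  - exact: (measurableT_comp mHC (pair1_measurable x)).
rewrite ge0_integralD//; last 4 first.
- by move=> x _; exact: integral_ge0.
- exact: (@measurable_uncurry_integral _ _ _ _ _ leb (H s t phi psi) (mH _ _ _ _ mphi mpsi)).
- by move=> x _; exact: integral_ge0.
- exact: (@measurable_uncurry_integral _ _ _ _ _ leb (fun x y => H t s psi phi y x) mHC).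
apply: leeD; last exact: half.
rewrite (@ge0_integral_swap _ _ _ _ _ leb leb (H s t phi psi) (mH _ _ _ _ mphi mpsi))//.
exact: half.
Qed.

(** * The Riesz kernel on R^n *)

Lemma edist_ge0 (R : realType) (n : nat) (x y : n.-tuple R) : 0 <= Defs.edist x y.
Proof. exact: sqrtr_ge0. Qed.

Lemma edist_cons (R : realType) (n : nat) (a b : R) (x y : n.-tuple R) :
  Defs.edist [tuple of a :: x] [tuple of b :: y] =
  Num.sqrt ((a - b) ^+ 2 + Defs.edist x y ^+ 2).
Proof.
rewrite /Defs.edist big_ord_recl !tnth0 sqr_sqrtr; last first.
  by apply: sumr_ge0 => i _; exact: sqr_ge0.
by congr (Num.sqrt (_ + _)); apply: eq_bigr => i _; rewrite !tnthS.
Qed.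

Lemma measurable_edist (R : realType) (n : nat) :
  measurable_fun [set: n.-tuple R * n.-tuple R] (fun z => Defs.edist z.1 z.2).
Proof.
apply: (measurableT_comp (f := @Num.sqrt R)).
  exact: (continuous_measurable_fun (@sqrt_continuous R)).
apply: measurable_sum => i; apply: measurable_funX; apply: measurable_funB.
  exact: (measurableT_comp (measurable_tnth i) measurable_fst).
exact: (measurableT_comp (measurable_tnth i) measurable_snd).
Qed.

(* Equal to 0 on the diagonal, as in [riesz]. *)
Definition riesz_kernel (R : realType) (n : nat) (alpha : R)
    (x y : n.-tuple R) : \bar R :=
  ((Defs.edist x y `^ (n%:R - alpha))^-1)%:E.

Lemma riesz_kernel_ge0 (R : realType) (n : nat) (alpha : R) (x y : n.-tuple R) :
  (0 <= riesz_kernel alpha x y)%E.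
Proof. by rewrite lee_fin invr_ge0 powR_ge0. Qed.

Lemma measurable_riesz_kernel (R : realType) (n : nat) (alpha : R) :
  measurable_fun [set: n.-tuple R * n.-tuple R]
    (fun z => riesz_kernel alpha z.1 z.2).
Proof.
apply/measurable_EFinP; under eq_fun do rewrite -powRN.
exact: (measurableT_comp (measurable_powR _) (@measurable_edist R n)).
Qed.

(* The Euclidean norm dominates each coordinate, so |x - y|^(-lam n) is at
   most the product of the n one-dimensional kernels |x_i - y_i|^(-lam). *)
Lemma le_tensor_kernel1 (R : realType) (n : nat) (lam d : R)
    (x y : n.-tuple R) :
  0 < lam -> 0 < d -> Defs.edist x y <= d ->
  ((d `^ (- (lam * n%:R)))%:E <= tensor_kernel (@kernel1 R lam) x y)%E.
Proof.
(* The bound d stays fixed along the induction: it dominates both |a - b| and the distance of the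
   tails, so each coordinate contributes one factor d^(-lam). *)
move=> lam0 d0; elim: n x y => [|n IH] x y.
  by move=> _ /=; rewrite mulr0 oppr0 powRr0.
case/tupleP: x => a x; case/tupleP: y => b y.
rewrite edist_cons tensor_kernel_cons => le_d.
have sqd : (a - b) ^+ 2 + Defs.edist x y ^+ 2 <= d ^+ 2.
  rewrite -(@sqr_sqrtr _ ((a - b) ^+ 2 + _)) ?addr_ge0 ?sqr_ge0//.
  by rewrite lerXn2r// nnegrE ?sqrtr_ge0// ltW.
have ab : `|a - b| <= d.
  rewrite -(@ler_pXn2r _ 2)// ?nnegrE ?normr_ge0 ?(ltW d0)//.
  by rewrite real_normK ?num_real//; apply: le_trans sqd; rewrite lerDl sqr_ge0.
have xy : Defs.edist x y <= d.
  rewrite -(@ler_pXn2r _ 2)// ?nnegrE ?edist_ge0 ?(ltW d0)//.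
  by apply: le_trans sqd; rewrite lerDr sqr_ge0.
have -> : - (lam * n.+1%:R) = - lam + - (lam * n%:R) by rewrite -natr1; ring.
rewrite powRD; last by apply/implyP => _; rewrite gt_eqF.
rewrite EFinM lee_pmul ?lee_fin ?powR_ge0//; last exact: IH.
rewrite /kernel1; case: ifPn => [_|neq]; first by rewrite leey.
rewrite lee_fin !powRN lef_pV2 ?posrE ?powR_gt0 ?normr_gt0 ?subr_eq0//.
by rewrite ge0_ler_powR ?nnegrE ?(ltW lam0) ?(ltW d0).
Qed.

(** The one-dimensional exponent is lam = 1 - alpha/n: then lam n = n - alpha, and the condition on
    s + t becomes s + t + lam = 2. *)
Lemma bilinear_bound_riesz (R : realType) (n : nat) (alpha s t : R) :
  (0 < n)%N -> 0 < alpha < n%:R -> 0 < s < 1 -> 0 < t < 1 ->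
  s + t = 1 + alpha / n%:R ->
  exists2 C : R, 0 < C &
    bilinear_bound (lebesgue_tuple R n) (@riesz_kernel R n alpha) s t C.
Proof.
move=> n0 /andP[a0 an] hs ht st.
have n0' : 0 < n%:R :> R by rewrite ltr0n.
pose lam := 1 - alpha / n%:R.
have lam0 : 0 < lam by rewrite subr_gt0 ltr_pdivrMr// mul1r.
have lam1 : lam < 1 by rewrite ltrBlDr ltrDl divr_gt0.
have lamE : lam * n%:R = n%:R - alpha.
  by rewrite mulrBl mul1r divfK// gt_eqF.
have [|C C0 hC] := @bilinear_bound_kernel1 R lam s t hs ht ltac:(by rewrite lam0).
  by rewrite st /lam; ring.
have {}hC := tensor_bilinear_bound (measurable_kernel1 lam)
  (@kernel1_ge0 R lam) (n := n) (ltW C0) hC.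
exists (C ^+ n); first exact: exprn_gt0.
move=> phi psi mphi phi0 mpsi psi0; apply: le_trans (hC _ _ mphi phi0 mpsi psi0).
apply: ge0_le_integralT => x.
  by apply: integral_ge0 => y _; rewrite !mule_ge0 ?poweR_ge0// riesz_kernel_ge0.
apply: ge0_le_integralT => y.
  by rewrite !mule_ge0 ?poweR_ge0// riesz_kernel_ge0.
rewrite lee_wpmul2l ?mule_ge0 ?poweR_ge0//.
(* At distance zero the Riesz kernel takes the default value 0, so nonnegativity of the tensor
   kernel suffices there. *)
have := edist_ge0 x y; rewrite le_eqVlt => /predU1P[xy|xy].
  rewrite /riesz_kernel -xy powR0 ?invr0; last by rewrite gt_eqF// subr_gt0.
  exact: (tensor_kernel_ge0 (@kernel1_ge0 R lam)).
by rewrite /riesz_kernel -powRN -lamE le_tensor_kernel1.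
Qed.

(** * Potentials of abstract kernels *)

Section ereal_power.
Local Open Scope ereal_scope.
Context (R : realType).
Implicit Types (x y : \bar R) (p q r t : R).

Lemma le_poweR x y r : (0 <= r)%R -> 0 <= x -> x <= y -> x `^ r <= y `^ r.
Proof.
move=> r0 x0 xy; apply: gt0_ler_poweR => //; rewrite in_itv/= leey andbT//.
exact: le_trans xy.
Qed.

Lemma poweRD_pos x p q : (0 < p)%R -> (0 < q)%R ->
  x `^ (p + q) = x `^ p * x `^ q.
Proof.
by move=> p0 q0; rewrite poweRD// add_neq0_poweRD_def// gt_eqF// addr_gt0.
Qed.

(** Follows from x + y <= 2 max(x, y), hence also for q < 1, where the power is not convex. *)
Lemma poweR_add_le x y q : (0 < q)%R -> 0 <= x -> 0 <= y ->
  (x + y) `^ q <= (2 `^ q)%:E * (x `^ q + y `^ q).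
Proof.
move=> q0 x0 y0.
have aux (a b : \bar R) : 0 <= a -> 0 <= b -> a <= b ->
    (a + b) `^ q <= (2 `^ q)%:E * (a `^ q + b `^ q).
  move=> a0 b0 ab; apply: (@le_trans _ _ ((2%:E * b) `^ q)).
    apply: le_poweR; [exact: ltW|exact: adde_ge0|].
    by rewrite mule_natl mule2n leeD2r.
  by rewrite poweRM ?lee_fin// poweR_EFin lee_wpmul2l ?lee_fin ?powR_ge0// leeDr// poweR_ge0.
have [xy|/ltW yx] := leP x y; first exact: aux.
by rewrite addeC [X in _ * X]addeC; exact: aux.
Qed.

Lemma poweR_young x y t : (0 < t < 1)%R -> 0 <= x -> 0 <= y ->
  x `^ t * y `^ (1 - t) <= x + y.
Proof.
move=> t01 x0 y0.
have [->|xoo] := eqVneq x +oo.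
  by rewrite addye ?leey//; case: y y0.
have [->|yoo] := eqVneq y +oo.
  by rewrite addey ?leey//; case: x x0 xoo.
case: x x0 xoo => [a|//|//]; rewrite lee_fin => a0 _.
case: y y0 yoo => [b|//|//]; rewrite lee_fin => b0 _.
by rewrite !poweR_EFin -EFinM -EFinD lee_fin powR_young.
Qed.

End ereal_power.

Section potential.
Local Open Scope ereal_scope.
Context d (T : measurableType d) (R : realType).
Variable mu : {sigma_finite_measure set T -> \bar R}.

(** Monotone convergence for truncations in height and in domain. These have finite integrals, which
    the duality argument for potentials has to cancel. *)
Lemma ge0_integral_le_truncated (H : T -> \bar R) (M : \bar R) (S : (set T)^nat) :
  measurable_fun setT H -> (forall x, 0 <= H x) ->
  nondecreasing_seq S -> (forall k, measurable (S k)) ->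
  setT = \bigcup_k S k ->
  (forall k, \int[mu]_x (mine (H x) k%:R%:E * (\1_(S k) x)%:E) <= M) ->
  \int[mu]_x H x <= M.
Proof.
move=> mH H0 ndS mS TS hM.
pose g k x := mine (H x) k%:R%:E * (\1_(S k) x)%:E.
have g0 k x : 0 <= g k x.
  by rewrite mule_ge0 ?lee_fin// le_min H0 lee_fin ler0n.
have mg k : measurable_fun setT (g k).
  apply: emeasurable_funM; first exact: measurable_mine.
  by apply/measurable_EFinP; exact: measurable_indic.
have ndg x : nondecreasing_seq (g ^~ x).
  move=> i j ij; rewrite /g lee_pmul//.
  - by rewrite le_min H0 lee_fin ler0n.
  - by rewrite le_min ge_min lexx/= ge_min lee_fin ler_nat ij orbT.
  - rewrite lee_fin !indicE ler_nat; case: (boolP (x \in S i)) => //.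
    rewrite inE => Six; rewrite mem_set//.
    by move: x Six; apply/subsetPset; exact: ndS.
have cvgg x : g ^~ x @ \oo --> H x.
  have : setT x by [].
  rewrite TS => -[k0 _ Sx].
  have inS k : (k0 <= k)%N -> (\1_(S k) x : R) = 1%R.
    move=> k0k; rewrite indicE mem_set//.
    by move: x Sx; apply/subsetPset; exact: ndS.
  case Hx : (H x) (H0 x) => [r| |] // _.
  - apply: cvg_near_cst; near=> k.
    rewrite /g inS; last by near: k; exact: nbhs_infty_ge.
    rewrite mule1 Hx; apply/min_idPl; rewrite lee_fin; near: k.
    exact: nbhs_infty_ger.
  - apply/cvgeyPge => A; near=> k.
    rewrite /g inS; last by near: k; exact: nbhs_infty_ge.
    rewrite mule1 Hx; have -> : mine +oo (k%:R%:E : \bar R) = k%:R%:E.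
      by apply/min_idPr; rewrite leey.
    by rewrite lee_fin; near: k; exact: nbhs_infty_ger.
have := @cvg_monotone_convergence _ _ _ mu _ measurableT g mg
  (fun n x _ => g0 n x) (fun x _ => ndg x).
rewrite (_ : \int[mu]_x limn (g ^~ x) = \int[mu]_x H x); last first.
  by apply: eq_integral => x _; apply/cvg_lim => //; exact: cvgg.
move=> cvgI; rewrite -(cvg_lim _ cvgI)//; apply: lime_le.
  by apply/cvg_ex; exists (\int[mu]_x H x).
by apply: nearW => k; exact: hM.
Unshelve. all: by end_near. Qed.

(** Hölder's inequality with constant 2: after dividing X by a and Y by b, Young's inequality bounds
    the product by a sum of integral at most 2. *)
Lemma ge0_hoelder_le (X Y : T -> \bar R) (t a b : R) :
  (0 < t < 1)%R -> (0 < a)%R -> (0 < b)%R ->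
  measurable_fun setT X -> (forall x, 0 <= X x) ->
  measurable_fun setT Y -> (forall x, 0 <= Y x) ->
  \int[mu]_x X x <= a%:E -> \int[mu]_x Y x <= b%:E ->
  \int[mu]_x (X x `^ t * Y x `^ (1 - t)) <= (2 * (a `^ t * b `^ (1 - t)))%:E.
Proof.
move=> t01 a0 b0 mX X0 mY Y0 Xa Yb.
pose c := (a `^ t * b `^ (1 - t))%R.
have c0 : (0 <= c)%R by rewrite mulr_ge0// powR_ge0.
apply: (@le_trans _ _ (\int[mu]_x (c%:E * (a^-1%:E * X x + b^-1%:E * Y x)))).
  apply: ge0_le_integralT => x; first by rewrite mule_ge0// poweR_ge0.
  apply: (@le_trans _ _ (c%:E * ((a^-1%:E * X x) `^ t * (b^-1%:E * Y x) `^ (1 - t)))).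
    rewrite !poweRM ?lee_fin ?invr_ge0 ?(ltW a0) ?(ltW b0)// !poweR_EFin.
    rewrite muleACA -EFinM (muleA c%:E) -EFinM /c mulrACA -!powRM ?invr_ge0 ?(ltW a0) ?(ltW b0)//.
    by rewrite !mulfV ?gt_eqF// !powR1 mulr1 mul1e.
  rewrite lee_wpmul2l ?lee_fin// poweR_young//.
    by rewrite mule_ge0// lee_fin invr_ge0 ltW.
  by rewrite mule_ge0// lee_fin invr_ge0 ltW.
have mX' : measurable_fun setT (fun x => a^-1%:E * X x) by exact: measurable_funeM.
have mY' : measurable_fun setT (fun x => b^-1%:E * Y x) by exact: measurable_funeM.
have X'0 x : 0 <= a^-1%:E * X x by rewrite mule_ge0// lee_fin invr_ge0 ltW.
have Y'0 x : 0 <= b^-1%:E * Y x by rewrite mule_ge0// lee_fin invr_ge0 ltW.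
rewrite ge0_integralZl//; last 2 first.
- exact: emeasurable_funD.
- by move=> x _; rewrite adde_ge0.
rewrite ge0_integralD// !ge0_integralZl ?lee_fin ?invr_ge0 ?(ltW a0) ?(ltW b0)//.
rewrite -/c (mulrC 2%R) (EFinM c) lee_wpmul2l ?lee_fin//.
rewrite (_ : 2%:E = (1 + 1)%:E)// EFinD leeD//.
  by rewrite muleC lee_pdivrMr// mul1e.
by rewrite muleC lee_pdivrMr// mul1e.
Qed.

Variable K : T -> T -> \bar R.
Hypothesis mK : measurable_fun [set: T * T] (fun z => K z.1 z.2).
Hypothesis K0 : forall x y, 0 <= K x y.

Definition potential (f : T -> \bar R) (x : T) := \int[mu]_y (f y * K x y).

Lemma potential_ge0 f x : (forall y, 0 <= f y) -> 0 <= potential f x.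
Proof. by move=> f0; apply: integral_ge0 => y _; rewrite mule_ge0. Qed.

Lemma measurable_potential f : measurable_fun setT f -> (forall y, 0 <= f y) ->
  measurable_fun setT (potential f).
Proof.
move=> mf f0.
apply: (@measurable_uncurry_integral _ _ _ _ _ mu (fun x y => f y * K x y)).
  apply: emeasurable_funM => //.
  exact: (measurableT_comp mf measurable_snd).
by move=> x y; rewrite mule_ge0.
Qed.

Lemma le_potential f g x : (forall y, 0 <= f y) -> (forall y, f y <= g y) ->
  potential f x <= potential g x.
Proof.
move=> f0 fg; apply: ge0_le_integralT => y; first by rewrite mule_ge0.
by rewrite lee_wpmul2r.
Qed.

Let measurable_integrand f x : measurable_fun setT f ->
  measurable_fun setT (fun y => f y * K x y).
Proof.
move=> mf; apply: emeasurable_funM => //.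
exact: (measurableT_comp mK (pair1_measurable x)).
Qed.

Lemma potentialD f g x : measurable_fun setT f -> (forall y, 0 <= f y) ->
  measurable_fun setT g -> (forall y, 0 <= g y) ->
  potential (fun y => f y + g y) x = potential f x + potential g x.
Proof.
move=> mf f0 mg g0; rewrite /potential -ge0_integralD//.
- by apply: eq_integral => y _; rewrite ge0_muleDl.
- by move=> y _; rewrite mule_ge0.
- exact: measurable_integrand.
- by move=> y _; rewrite mule_ge0.
- exact: measurable_integrand.
Qed.

Lemma potentialZ f (c : R) x : measurable_fun setT f -> (forall y, 0 <= f y) ->
  (0 <= c)%R -> potential (fun y => c%:E * f y) x = c%:E * potential f x.
Proof.
move=> mf f0 c0; rewrite /potential -ge0_integralZl//.
- by apply: eq_integral => y _; rewrite muleA.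
- exact: measurable_integrand.
- by move=> y _; rewrite mule_ge0.
Qed.

(** * Mapping properties of the potential, with [beta] in the role of alpha / n *)

Variable beta : R.
Hypothesis beta01 : (0 < beta < 1)%R.
Hypothesis hls : forall s t : R, (0 < s < 1)%R -> (0 < t < 1)%R ->
  (s + t = 1 + beta)%R -> exists2 C : R, (0 < C)%R & bilinear_bound mu K s t C.

(* Duality: test the bilinear bound against truncations of the r-th power
   of the potential, r = 1 / (t - beta), whose integrals are finite. *)
Lemma potential_integral_le (t : R) : (beta < t < 1)%R ->
  exists2 C : R, (0 < C)%R & forall (phi : T -> \bar R) (a : R),
    measurable_fun setT phi -> (forall x, 0 <= phi x) -> (0 < a)%R ->
    \int[mu]_x phi x <= a%:E ->
    \int[mu]_x potential (fun y => phi y `^ t) x `^ ((t - beta)^-1)%R <=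
      (C * a `^ (t * (t - beta)^-1))%:E.
Proof.
move: beta01 => /andP[b0 b1] /andP[bt t1].
pose s := (1 + beta - t)%R.
have s01 : (0 < s < 1)%R by rewrite /s; lra.
have t01 : (0 < t < 1)%R by lra.
have [C C0 hC] := hls s01 t01 (subrK t (1 + beta)%R).
pose r := ((t - beta)^-1)%R.
have tb0 : (0 < t - beta)%R by rewrite subr_gt0.
have r0 : (0 < r)%R by rewrite invr_gt0.
exists (C `^ r)%R; first exact: powR_gt0.
move=> phi a mphi phi0 a0 phia.
have mphit : measurable_fun setT (fun y => phi y `^ t).
  exact: (measurableT_comp (measurable_poweR t)).
have phit0 y : 0 <= phi y `^ t by exact: poweR_ge0.
set h := potential (fun y => phi y `^ t).
have h0 x : 0 <= h x by exact: potential_ge0.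
have mh : measurable_fun setT h by exact: measurable_potential.
have /sigma_finiteP[S [TS ndS Sfin]] := sigma_finiteT mu.
apply: (@ge0_integral_le_truncated _ _ S) => //.
- exact: (measurableT_comp (measurable_poweR r)).
- by move=> x; exact: poweR_ge0.
- by move=> k; exact: (Sfin k).1.
move=> k.
pose psi x := mine (h x `^ r) k%:R%:E * (\1_(S k) x)%:E.
have min0 x : 0 <= mine (h x `^ r) k%:R%:E.
  by rewrite le_min poweR_ge0 lee_fin ler0n.
have psi0 x : 0 <= psi x by rewrite mule_ge0 ?lee_fin.
have mpsi : measurable_fun setT psi.
  apply: emeasurable_funM.
    by apply: measurable_mine => //; exact: (measurableT_comp (measurable_poweR r)).
  by apply/measurable_EFinP; apply: measurable_indic; exact: (Sfin k).1.
have psifin : \int[mu]_x psi x < +oo.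
  apply: (@le_lt_trans _ _ (\int[mu]_x (k%:R%:E * (\1_(S k) x)%:E))).
    apply: ge0_le_integralT => // x; rewrite lee_wpmul2r ?lee_fin//.
    by rewrite ge_min lexx orbT.
  rewrite ge0_integralZl ?lee_fin ?ler0n//; last first.
    by apply/measurable_EFinP; apply: measurable_indic; exact: (Sfin k).1.
  rewrite integral_indic//; last exact: (Sfin k).1.
  by rewrite setIT lte_mul_pinfty// ?lee_fin ?ler0n//; exact: (Sfin k).2.
have key : \int[mu]_x psi x <= C%:E * ((\int[mu]_x psi x) `^ s * (a `^ t)%:E).
  apply: (@le_trans _ _ (C%:E * ((\int[mu]_x psi x) `^ s * (\int[mu]_x phi x) `^ t))); last first.
    rewrite lee_wpmul2l ?lee_fin ?(ltW C0)// lee_wpmul2l ?poweR_ge0//.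
    by rewrite -poweR_EFin le_poweR ?integral_ge0//; lra.
  apply: le_trans (hC _ _ mpsi psi0 mphi phi0).
  apply: ge0_le_integralT => // x.
  under eq_integral do rewrite -muleA.
  rewrite ge0_integralZl ?poweR_ge0//; last 2 first.
  - exact: measurable_integrand.
  - by move=> y _; rewrite mule_ge0.
  rewrite -/(potential _ x) -/h.
  (* Since s + (t - beta) = 1 and psi <= h^r, psi is at most psi^s h, whose integral is the bilinear
     form in psi and phi. *)
  have psi1 : psi x = psi x `^ s * psi x `^ (t - beta).
    rewrite -poweRD_pos//; last by case/andP: s01.
    by rewrite (_ : _ + _ = 1)%R ?poweRe1// /s; ring.
  rewrite [leLHS]psi1 lee_wpmul2l ?poweR_ge0//.
  apply: (@le_trans _ _ ((h x `^ r) `^ (t - beta))).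
    apply: le_poweR => //; first exact: ltW.
    rewrite /psi indicE; case: (x \in S k).
      by rewrite mule1 ge_min lexx.
    by rewrite mule0 poweR_ge0.
  by rewrite -poweRrM mulVf ?gt_eqF// poweRe1.
have : 0 <= \int[mu]_x psi x by exact: integral_ge0.
rewrite -/psi; case: (\int[mu]_x psi x) psifin key => [N|//|//] _.
rewrite poweR_EFin -!EFinM !lee_fin => key N0.
rewrite powRrM -powRM ?powR_ge0 ?(ltW C0)//.
(* The integral N of the truncation is finite, so for N > 0 the factor N^s cancels and leaves N^(t -
   beta) <= C a^t; the r-th power of this is the claim. *)
move: N0; rewrite le_eqVlt => /predU1P[<-|N0]; first exact: powR_ge0.
have : (N `^ (t - beta) <= C * a `^ t)%R.
  have : (N `^ s * N `^ (t - beta) <= N `^ s * (C * a `^ t))%R.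
    rewrite -powRD; last by apply/implyP => _; rewrite gt_eqF.
    rewrite (_ : s + (t - beta) = 1)%R; last by rewrite /s; ring.
    by rewrite (powRr1 (ltW N0)) mulrCA.
  by rewrite ler_pM2l// powR_gt0.
move=> Nle; rewrite -[leLHS](powRr1 (ltW N0)).
rewrite -[X in (N `^ X)%R](mulfV (x := (t - beta)%R)) ?gt_eqF//.
by rewrite powRrM ge0_ler_powR ?nnegrE ?(ltW r0) ?powR_ge0// mulr_ge0 ?powR_ge0 ?(ltW C0).
Qed.

(* The operator T of the header, with U in the role of the truncated u. *)
Definition lifting (p q : R) (U w : T -> \bar R) : T -> \bar R :=
  potential (fun y => U y `^ (p - q^-1) *
    potential (fun z => w z `^ q) y `^ (q^-1)%R).

Lemma measurable_lifting p q U w :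
  measurable_fun setT U -> measurable_fun setT w ->
  measurable_fun setT (lifting p q U w).
Proof.
move=> mU mw; apply: measurable_potential => [|y]; last first.
  by rewrite mule_ge0// poweR_ge0.
apply: emeasurable_funM; first exact: (measurableT_comp (measurable_poweR _)).
apply: (measurableT_comp (measurable_poweR _)).
apply: measurable_potential => [|y]; last exact: poweR_ge0.
exact: (measurableT_comp (measurable_poweR _)).
Qed.

Lemma lifting_ge0 p q U w x : 0 <= lifting p q U w x.
Proof. by apply: potential_ge0 => y; rewrite mule_ge0// poweR_ge0. Qed.

(** The inner potential sends w^q into L^rho, Hölder's inequality multiplies by the power of U, and
    the outer potential returns to L^sigma. The exponents close up because of the scaling relation
    between p, q and r. The positive power of e makes the operator small when U is small in L^r. *)
Lemma lifting_integral_le (p q r sigma : R) :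
  (0 < q)%R -> (0 < r)%R -> (0 < sigma)%R -> (beta < q / sigma < 1)%R ->
  (sigma^-1 + beta < 1)%R -> ((p - q^-1) / r = beta * (1 + q^-1))%R ->
  exists2 C : R, (0 < C)%R & forall (U w : T -> \bar R) (e m : R),
    measurable_fun setT U -> (forall x, 0 <= U x) ->
    measurable_fun setT w -> (forall x, 0 <= w x) ->
    (0 < e)%R -> (0 < m)%R ->
    \int[mu]_x U x `^ r <= e%:E -> \int[mu]_x w x `^ sigma <= m%:E ->
    \int[mu]_x lifting p q U w x `^ sigma <=
      (C * e `^ (sigma * (beta * (1 + q^-1))) * m)%:E.
Proof.
move=> q0 r0 sigma0 qs sb pr.
move: beta01 => /andP[b0 b1].
have iq0 : (0 < q^-1)%R by rewrite invr_gt0.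
have is0 : (0 < sigma^-1)%R by rewrite invr_gt0.
have [C1 C10 hC1] := potential_integral_le qs.
have [C2 C20 hC2] := @potential_integral_le (sigma^-1 + beta)%R ltac:(lra).
move: hC2; rewrite (_ : (sigma^-1 + beta - beta)^-1 = sigma)%R; last first.
  by rewrite addrK invrK.
move=> hC2.
set th1 := (q / sigma)%R in qs hC1.
set th2 := (sigma^-1 + beta)%R in sb hC2.
have th20 : (0 < th2)%R by rewrite addr_gt0.
have th1b : (0 < th1 - beta)%R by rewrite subr_gt0; case/andP: qs.
(* The Hölder weight for which U^(p - 1/q) h^(1/q) is the power th2 of (U^r)^kap (h^rho)^(1 - kap);
   this requires r kap th2 = p - 1/q and rho (1 - kap) th2 = 1/q. *)
pose kap := (beta * (1 + q^-1) / th2)%R.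
have kapE : (kap * th2 = beta * (1 + q^-1))%R by rewrite divfK// gt_eqF.
have kapE' : ((1 - kap) * th2 = (th1 - beta) / q)%R.
  by rewrite mulrBl mul1r kapE /th2 /th1; field; rewrite !gt_eqF.
have kap01 : (0 < kap < 1)%R.
  apply/andP; split; first by rewrite divr_gt0// mulr_gt0// addr_gt0.
  rewrite -subr_gt0 -(pmulr_lgt0 _ th20) kapE'.
  by rewrite divr_gt0.
clearbody kap.
exists (C2 * 2 `^ (th2 * sigma) * C1 `^ (sigma * ((th1 - beta) / q)))%R.
  by rewrite !mulr_gt0// powR_gt0.
move=> U w e m mU U0 mw w0 e0 m0 Ue wm.
have mws : measurable_fun setT (fun x => w x `^ sigma).
  exact: (measurableT_comp (measurable_poweR _)).
have mUr : measurable_fun setT (fun x => U x `^ r).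
  exact: (measurableT_comp (measurable_poweR _)).
pose h := potential (fun z => w z `^ q).
have mh : measurable_fun setT h.
  apply: measurable_potential => [|y]; last exact: poweR_ge0.
  exact: (measurableT_comp (measurable_poweR _)).
have h0 x : 0 <= h x by apply: potential_ge0 => y; exact: poweR_ge0.
set rho := ((th1 - beta)^-1)%R in hC1 *.
pose b := (C1 * m `^ (th1 * rho))%R.
have hb : \int[mu]_x h x `^ rho <= b%:E.
  have E1 : (fun z => w z `^ q) = fun z => (w z `^ sigma) `^ th1.
    by apply/funext => z; rewrite -poweRrM /th1 mulrC divfK// gt_eqF.
  by rewrite /h E1; apply: (hC1 (fun z => w z `^ sigma)) => // z; exact: poweR_ge0.
have bgt0 : (0 < b)%R by rewrite mulr_gt0// powR_gt0.
have mhr : measurable_fun setT (fun x => h x `^ rho).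
  exact: (measurableT_comp (measurable_poweR _)).
pose a := (2 * (e `^ kap * b `^ (1 - kap)))%R.
have a0 : (0 < a)%R by rewrite !mulr_gt0// powR_gt0.
pose phi y := (U y `^ r) `^ kap * (h y `^ rho) `^ (1 - kap).
have ha : \int[mu]_x phi x <= a%:E.
  by apply: ge0_hoelder_le => // x; exact: poweR_ge0.
have mphi : measurable_fun setT phi.
  by apply: emeasurable_funM; exact: (measurableT_comp (measurable_poweR _)).
have phi0 x : 0 <= phi x by rewrite mule_ge0// poweR_ge0.
have E2 : (fun y => U y `^ (p - q^-1) * h y `^ (q^-1)%R) = fun y => phi y `^ th2.
  apply/funext => y; rewrite poweRM ?poweR_ge0// -!poweRrM kapE kapE'.
  rewrite (_ : r * _ = p - q^-1)%R; last by rewrite -pr mulrC divfK// gt_eqF.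
  by rewrite (_ : rho * _ = q^-1)%R// /rho mulKf// gt_eqF.
rewrite /lifting -/h E2; apply: le_trans (hC2 _ _ mphi phi0 a0 ha) _.
rewrite lee_fin le_eqVlt; apply/orP; left; apply/eqP.
rewrite /a !powRM ?mulr_ge0 ?powR_ge0 ?(ltW C10)//.
rewrite -!powRrM (mulrA kap) kapE (mulrA (1 - kap)%R) kapE'.
clear phi mphi phi0 ha E2 a a0.
have rhoE : (rho * (th1 - beta) = 1)%R by rewrite mulVf// gt_eqF.
have th1E : (th1 * sigma = q)%R by rewrite divfK// gt_eqF.
(* The power of m is th1 sigma / q = 1, in accordance with [lifting] being homogeneous of degree one
   in w. *)
rewrite (_ : th1 * rho * _ = 1)%R; last first.
  clearbody rho th1; transitivity ((rho * (th1 - beta)) * (th1 * sigma) / q)%R.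
    by ring.
  by rewrite rhoE th1E mul1r mulfV// gt_eqF.
rewrite powRr1 ?(ltW m0)// (mulrC ((th1 - beta) / q)%R sigma).
rewrite (mulrC (beta * (1 + q^-1))%R sigma).
move: (C1 `^ _)%R (e `^ _)%R (2 `^ _)%R => A B D.
by clear; ring.
Qed.

Definition low_part (U : T -> \bar R) (del : R) (y : T) : \bar R :=
  if U y <= del%:E then U y else 0.

Definition high_part (U : T -> \bar R) (del : R) (y : T) : \bar R :=
  if U y <= del%:E then 0 else U y.

Lemma measurable_low_part U del : measurable_fun setT U ->
  measurable_fun setT (low_part U del).
Proof.
by move=> mU; apply: measurable_fun_ifT => //; exact: measurable_fun_lee.
Qed.

Lemma measurable_high_part U del : measurable_fun setT U ->
  measurable_fun setT (high_part U del).
Proof.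
by move=> mU; apply: measurable_fun_ifT => //; exact: measurable_fun_lee.
Qed.

(** Where U <= del, one factor U^(1/q) of U^p is replaced through U = I(V^q) and V <= a + b;
    elsewhere U^p goes into the high part. Splitting (a + b)^q costs 2^q, which becomes 2 under the
    power 1/q, and splitting that power of a sum costs 2^(1/q). *)
Lemma lifting_split p q (U V a b : T -> \bar R) (del : R) (x : T) :
  (0 < q)%R -> (1 < p * q)%R ->
  measurable_fun setT U -> (forall y, 0 <= U y) ->
  measurable_fun setT a -> (forall y, 0 <= a y) ->
  measurable_fun setT b -> (forall y, 0 <= b y) ->
  (forall y, 0 <= V y) -> (forall y, V y <= a y + b y) ->
  (forall y, U y = potential (fun z => V z `^ q) y) ->
  potential (fun y => U y `^ p) x <=
    (2 * 2 `^ q^-1)%:E * (lifting p q (low_part U del) a x + lifting p q (low_part U del) b x) +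
    potential (fun y => high_part U del y `^ p) x.
Proof.
move=> q0 pq1 mU U0 ma a0 mb b0 V0 Vab UE.
pose Ulow := low_part U del; pose Uhigh := high_part U del.
have iq0 : (0 < q^-1)%R by rewrite invr_gt0.
have pq0 : (0 < p - q^-1)%R.
  by rewrite subr_gt0 -div1r ltr_pdivrMr.
have p0 : (0 < p)%R by rewrite (lt_trans iq0)// -subr_gt0.
have mUlow : measurable_fun setT Ulow by exact: measurable_low_part.
have mUhigh : measurable_fun setT Uhigh by exact: measurable_high_part.
have mpow (f : T -> \bar R) t : measurable_fun setT f ->
    measurable_fun setT (fun y => f y `^ t).
  by move=> mf; exact: (measurableT_comp (measurable_poweR _)).
pose X := potential (fun z => a z `^ q).
pose Y := potential (fun z => b z `^ q).
have X0 y : 0 <= X y by apply: potential_ge0 => z; exact: poweR_ge0.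
have Y0 y : 0 <= Y y by apply: potential_ge0 => z; exact: poweR_ge0.
have mX : measurable_fun setT X.
  by apply: measurable_potential => [|y]; [exact: mpow|exact: poweR_ge0].
have mY : measurable_fun setT Y.
  by apply: measurable_potential => [|y]; [exact: mpow|exact: poweR_ge0].
have UXY y : U y <= (2 `^ q)%:E * (X y + Y y).
  have pw0 f t (z : T) : 0 <= f z `^ t by exact: poweR_ge0.
  rewrite UE -potentialD; [|exact: mpow|exact: pw0|exact: mpow|exact: pw0].
  rewrite -potentialZ ?powR_ge0//; last 2 first.
  - by apply: emeasurable_funD; exact: mpow.
  - by move=> z; rewrite adde_ge0.
  apply: le_potential => z; first exact: poweR_ge0.
  apply: le_trans (poweR_add_le q0 (a0 z) (b0 z)).
  by apply: le_poweR => //; exact: ltW.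
have UqXY y : U y `^ (q^-1)%R <=
    (2 * 2 `^ q^-1)%:E * (X y `^ (q^-1)%R + Y y `^ (q^-1)%R).
  apply: (@le_trans _ _ (((2 `^ q)%:E * (X y + Y y)) `^ (q^-1)%R)).
    by apply: le_poweR => //; exact: ltW.
  rewrite poweRM ?lee_fin ?powR_ge0//; last by rewrite adde_ge0.
  rewrite poweR_EFin -powRrM mulfV ?gt_eqF//.
  rewrite powRr1// EFinM -muleA lee_wpmul2l ?lee_fin//.
  exact: poweR_add_le.
pose ga y := Ulow y `^ (p - q^-1) * X y `^ (q^-1)%R.
pose gb y := Ulow y `^ (p - q^-1) * Y y `^ (q^-1)%R.
have ga0 y : 0 <= ga y by rewrite mule_ge0// poweR_ge0.
have gb0 y : 0 <= gb y by rewrite mule_ge0// poweR_ge0.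
have mga : measurable_fun setT ga by apply: emeasurable_funM; exact: mpow.
have mgb : measurable_fun setT gb by apply: emeasurable_funM; exact: mpow.
have c0 : (0 <= 2 * 2 `^ q^-1 :> R)%R by rewrite mulr_ge0// powR_ge0.
rewrite /lifting -/X -/Y -/ga -/gb -potentialD// -potentialZ//; last 2 first.
- exact: emeasurable_funD.
- by move=> y; rewrite adde_ge0.
rewrite -potentialD//; last 4 first.
- by apply: measurable_funeM; exact: emeasurable_funD.
- by move=> y; rewrite mule_ge0 ?adde_ge0.
- exact: mpow.
- by move=> y; exact: poweR_ge0.
apply: le_potential => y; first exact: poweR_ge0.
rewrite /ga /gb /Ulow /low_part /high_part; case: ifPn => Ud.
  rewrite [X in _ <= _ + X]poweR0r ?gt_eqF// adde0.
  rewrite -ge0_muleDr ?poweR_ge0// muleCA.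
  rewrite -[X in U y `^ X](subrK q^-1%R p) poweRD_pos//.
  by rewrite lee_wpmul2l ?poweR_ge0.
by rewrite leeDr// mule_ge0// adde_ge0// mule_ge0// poweR_ge0.
Qed.

End potential.

(** * Regularity lifting *)

Section tails.
Local Open Scope ereal_scope.
Context d (T : measurableType d) (R : realType).
Variable mu : {sigma_finite_measure set T -> \bar R}.

(** Dominated convergence with majorant U^r: as U is positive, its part below 1/(n+1) is eventually
    zero at each point. *)
Lemma low_part_integral_small (U : T -> \bar R) (r e : R) :
  (0 < r)%R -> (0 < e)%R -> measurable_fun setT U -> (forall x, 0 < U x) ->
  \int[mu]_x U x `^ r < +oo ->
  exists2 del : R, (0 < del)%R & \int[mu]_x low_part U del x `^ r <= e%:E.
Proof.
move=> r0 e0 mU U0 Ufin.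
have mUr : measurable_fun setT (fun x => U x `^ r).
  exact: (measurableT_comp (measurable_poweR _)).
pose f n x := low_part U n.+1%:R^-1 x `^ r.
have f0 n x : 0 <= f n x by exact: poweR_ge0.
have [_ _ cvgf] : [/\ mu.-integrable setT (cst 0),
    [sequence \int[mu]_x `|f n x - cst 0 x|]_n @ \oo --> 0 &
    [sequence \int[mu]_x f n x]_n @ \oo --> \int[mu]_x (cst 0 : T -> \bar R) x].
  apply: (@dominated_convergence _ _ _ mu setT measurableT f (cst 0)
    (fun x => U x `^ r)) => //.
  - move=> n; apply: (measurableT_comp (measurable_poweR _)).
    exact: measurable_low_part.
  - apply: aeW => x _; apply: cvg_near_cst.
    have : \forall n \near \oo, (n.+1%:R^-1 : R)%:E < U x.
      case: (U x) (U0 x) => [u|_|//]; last by near=> n; rewrite ltry.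
      rewrite lte_fin => u0; near=> n; rewrite lte_fin; near: n.
      exact: (near_infty_natSinv_lt (PosNum u0)).
    apply: filterS => n nU; rewrite /f /low_part leNgt nU.
    by rewrite poweR0r// gt_eqF.
  - apply/integrableP; split => //.
    by under eq_integral do rewrite gee0_abs ?poweR_ge0//.
  - apply: aeW => x n _; rewrite gee0_abs// /f /low_part.
    by case: ifP => // _; rewrite poweR0r ?gt_eqF// poweR_ge0.
rewrite integral0 in cvgf.
apply: contrapT => H.
have : e%:E <= 0.
  apply: (cvge_to_ge cvgf); near=> n; rewrite leNgt; apply/negP => fe.
  by apply: H; exists (n.+1%:R^-1)%R; [rewrite invr_gt0 ltr0n|exact: ltW].
by rewrite lee_fin leNgt e0.
Unshelve. all: by end_near. Qed.

(** As V is positive, the sets where V > 1/(k+1) increase to the whole space, so a bound uniform in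
    [del] passes to the limit. *)
Lemma ge0_integral_le_positive (f : T -> \bar R) (V : T -> \bar R) (M : \bar R) :
  measurable_fun setT f -> (forall x, 0 <= f x) ->
  measurable_fun setT V -> (forall x, 0 < V x) ->
  (forall del : R, (0 < del)%R ->
    \int[mu]_(x in [set x | del%:E < V x]) f x <= M) ->
  \int[mu]_x f x <= M.
Proof.
move=> mf f0 mV V0 hM.
pose S (k : nat) := [set x | (k.+1%:R^-1 : R)%:E < V x].
have mS k : measurable (S k).
  by rewrite -[S k]setTI; exact: emeasurable_fun_o_infty.
have ndS : nondecreasing_seq S.
  move=> i j ij; apply/subsetPset => x; apply: le_lt_trans.
  by rewrite lee_fin lef_pV2 ?posrE ?ltr0n// ler_nat.
have ST : \bigcup_k S k = setT.
  apply/seteqP; split => // x _.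
  have [n _ hn] : \forall n \near \oo, (n.+1%:R^-1 : R)%:E < V x.
    case: (V x) (V0 x) => [u|_|//]; last by near=> n; rewrite ltry.
    rewrite lte_fin => u0; near=> n; rewrite lte_fin; near: n.
    exact: (near_infty_natSinv_lt (PosNum u0)).
  by exists n => //; exact: hn n (leqnn _).
have := @ge0_nondecreasing_set_cvg_integral _ _ _ S f mu ndS mS
  (fun i => measurable_funTS mf) (fun i x _ => f0 x).
rewrite ST => cvgI; apply: (cvge_to_le cvgI); near=> k.
by apply: hM; rewrite invr_gt0 ltr0n.
Unshelve. all: by end_near. Qed.

End tails.

Lemma ge0_fin_bound (R : realType) (x : \bar R) : (x < +oo)%E ->
  exists2 a : R, 0 < a & (x <= a%:E)%E.
Proof.
case: x => [r _|//|_]; last by exists 1 => //; rewrite leNye.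
exists (Num.max r 1); first by rewrite lt_max ltr01 orbT.
by rewrite lee_fin le_max lexx.
Qed.

(** The estimate covers all smaller e', so that the minimum of two thresholds serves two estimates
    at once. *)
Lemma exists_powR_small (R : realType) (B g : R) : 0 < B -> 0 < g ->
  exists2 e : R, 0 < e & forall e', 0 < e' <= e -> B * e' `^ g <= 2^-1.
Proof.
move=> B0 g0; exists ((2 * B)^-1 `^ g^-1).
  by rewrite powR_gt0// invr_gt0 mulr_gt0.
move=> e' /andP[e'0 e'e].
apply: (@le_trans _ _ (B * (2 * B)^-1)); last first.
  by rewrite invfM mulrCA mulfV ?mulr1// gt_eqF.
rewrite ler_wpM2l ?(ltW B0)//.
rewrite -[leRHS]powRr1 ?invr_ge0 ?mulr_ge0 ?(ltW B0)//.
rewrite -[X in _ <= _ `^ X](mulVf (x := g)) ?gt_eqF// powRrM.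
by rewrite ge0_ler_powR ?nnegrE ?powR_ge0 ?(ltW e'0) ?(ltW g0).
Qed.

Section regularity.
Local Open Scope ereal_scope.
Context d (T : measurableType d) (R : realType).
Variable mu : {sigma_finite_measure set T -> \bar R}.
Variable K : T -> T -> \bar R.
Hypothesis mK : measurable_fun [set: T * T] (fun z => K z.1 z.2).
Hypothesis K0 : forall x y, 0 <= K x y.
Variable beta : R.
Hypothesis beta01 : (0 < beta < 1)%R.
Hypothesis hls : forall s t : R, (0 < s < 1)%R -> (0 < t < 1)%R ->
  (s + t = 1 + beta)%R -> exists2 C : R, (0 < C)%R & bilinear_bound mu K s t C.

(** Put th = 1/sigma + beta. As p/th <= r, U^(p/th) is at most del^(p/th - r) U^r where U > del, so
    the high part lies in L^(p/th); the potential of its p-th power then lies in L^sigma. *)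
Lemma potential_high_part_integrable (p r sigma del : R) (U : T -> \bar R) :
  (0 < p)%R -> (0 < r)%R -> (0 < sigma)%R -> (sigma^-1 + beta < 1)%R ->
  (p / (sigma^-1 + beta) <= r)%R -> (0 < del)%R ->
  measurable_fun setT U -> (forall x, 0 <= U x < +oo) ->
  \int[mu]_x U x `^ r < +oo ->
  \int[mu]_x potential mu K (fun y => high_part U del y `^ p) x `^ sigma < +oo.
Proof.
move=> p0 r0 sigma0 sb pr del0 mU U0 Ufin.
move: beta01 => /andP[b0 b1].
set th := (sigma^-1 + beta)%R in sb pr.
have is0 : (0 < sigma^-1)%R by rewrite invr_gt0.
have th0 : (0 < th)%R by rewrite addr_gt0.
have thb : (beta < th < 1)%R by rewrite sb ltrDr is0.
have [C C0 hC] := potential_integral_le mK K0 beta01 hls thb.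
have mH := measurable_high_part del mU.
pose phi x := high_part U del x `^ (p / th).
have mphi : measurable_fun setT phi.
  exact: (measurableT_comp (measurable_poweR _)).
have phi0 x : 0 <= phi x by exact: poweR_ge0.
pose c := (del `^ (p / th - r))%R.
have c0 : (0 <= c)%R by exact: powR_ge0.
have phiU x : phi x <= c%:E * U x `^ r.
  rewrite /phi /high_part; case: ifPn => [_|].
    by rewrite poweR0r ?gt_eqF ?divr_gt0// mule_ge0// poweR_ge0.
  rewrite -ltNge; case: (U x) (U0 x) => [u|/andP[]//|//] /andP[].
  rewrite lee_fin => u0 _; rewrite lte_fin => du.
  have u1 : (0 < u)%R by exact: lt_trans du.
  rewrite !poweR_EFin -EFinM lee_fin -[X in (u `^ X)%R](subrK r).
  rewrite powRD; last by apply/implyP => _; rewrite gt_eqF.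
  rewrite ler_wpM2r ?powR_ge0// /c -opprB !powRN lef_pV2 ?posrE ?powR_gt0//.
  by rewrite ge0_ler_powR ?nnegrE ?subr_ge0 ?(ltW du)// ltW.
have [a a0 phia] : exists2 a : R, (0 < a)%R & \int[mu]_x phi x <= a%:E.
  apply: ge0_fin_bound.
  apply: (@le_lt_trans _ _ (\int[mu]_x (c%:E * U x `^ r))).
    exact: ge0_le_integralT.
  rewrite ge0_integralZl//.
  - by rewrite lte_mul_pinfty ?lee_fin.
  - exact: (measurableT_comp (measurable_poweR _)).
  - by move=> x _; exact: poweR_ge0.
have := hC _ _ mphi phi0 a0 phia.
have -> : (fun y => phi y `^ th) = fun y => high_part U del y `^ p.
  by apply/funext => y; rewrite -poweRrM divfK// gt_eqF.
have -> : (th - beta)^-1%R = sigma by rewrite /th addrK invrK.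
by move=> /le_lt_trans; apply; rewrite ltry.
Qed.

(* V is a fixed point of the contraction w |-> c T w + F up to the
   quasi-norm constant c, with F of finite sigma-norm. Iterating from
   V <= 0 + V produces V <= a + b with a bounded in L^sigma and b
   arbitrarily small in L^s. *)
Lemma fixpoint_decomposition (p q r s sigma : R) (U V : T -> \bar R) :
  (0 < q)%R -> (1 < p * q)%R -> (0 < r)%R -> (0 < sigma)%R -> (0 < s)%R ->
  ((p - q^-1) / r = beta * (1 + q^-1))%R ->
  (beta < q / s < 1)%R -> (s^-1 + beta < 1)%R ->
  (beta < q / sigma < 1)%R -> (sigma^-1 + beta < 1)%R ->
  (p / (sigma^-1 + beta) <= r)%R ->
  measurable_fun setT U -> (forall x, 0 < U x < +oo) ->
  measurable_fun setT V -> (forall x, 0 <= V x) ->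
  (forall x, U x = potential mu K (fun y => V y `^ q) x) ->
  (forall x, V x = potential mu K (fun y => U y `^ p) x) ->
  \int[mu]_x U x `^ r < +oo -> \int[mu]_x V x `^ s < +oo ->
  exists M : R, forall e : R, (0 < e)%R ->
    exists a b : T -> \bar R, [/\ measurable_fun setT a /\ (forall x, 0 <= a x),
      measurable_fun setT b /\ (forall x, 0 <= b x),
      forall x, V x <= a x + b x,
      \int[mu]_x a x `^ sigma <= M%:E & \int[mu]_x b x `^ s <= e%:E].
Proof.
move=> q0 pq1 r0 sigma0 s0 pr qs sb qsig sigb psr mU U0 mV V0 UE VE Ufin Vfin.
have iq0 : (0 < q^-1)%R by rewrite invr_gt0.
have pq0 : (0 < p - q^-1)%R by rewrite subr_gt0 -div1r ltr_pdivrMr.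
have p0 : (0 < p)%R by rewrite (lt_trans iq0)// -subr_gt0.
have bq0 : (0 < beta * (1 + q^-1))%R.
  by rewrite mulr_gt0 ?addr_gt0//; case/andP: beta01.
have [C1 C10 hC1] := lifting_integral_le mK K0 beta01 hls q0 r0 s0 qs sb pr.
have [C2 C20 hC2] := lifting_integral_le mK K0 beta01 hls q0 r0 sigma0 qsig sigb pr.
set g1 := (s * (beta * (1 + q^-1)))%R in hC1.
set g2 := (sigma * (beta * (1 + q^-1)))%R in hC2.
pose c : R := (2 * 2 `^ q^-1)%R.
have c0 : (0 < c)%R by rewrite mulr_gt0// powR_gt0.
(* For small eps, w |-> c T w halves the s-integral, and it halves the sigma-integral even with the
   factor 2^sigma lost in adding F. *)
have B10 : (0 < c `^ s * C1)%R by rewrite mulr_gt0// powR_gt0.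
have B20 : (0 < 2 `^ sigma * c `^ sigma * C2)%R by rewrite !mulr_gt0// powR_gt0.
have [e1 e10 he1] := exists_powR_small B10 (mulr_gt0 s0 bq0).
have [e2 e20 he2] := exists_powR_small B20 (mulr_gt0 sigma0 bq0).
pose eps := Num.min e1 e2.
have eps0 : (0 < eps)%R by rewrite lt_min e10.
have {}he1 : (c `^ s * C1 * eps `^ g1 <= 2^-1)%R.
  by apply: he1; rewrite eps0 ge_min lexx.
have {}he2 : (2 `^ sigma * c `^ sigma * C2 * eps `^ g2 <= 2^-1)%R.
  by apply: he2; rewrite eps0 ge_min lexx orbT.
have [del del0 Udel] := low_part_integral_small r0 eps0 mU
  (fun x => proj1 (andP (U0 x))) Ufin.
have U0' x : 0 <= U x by case/andP: (U0 x) => /ltW.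
have U0'' x : 0 <= U x < +oo by case/andP: (U0 x) => /ltW ->.
have mL := measurable_low_part del mU.
have L0 x : 0 <= low_part U del x by rewrite /low_part; case: ifP.
pose F := potential mu K (fun y => high_part U del y `^ p).
have F0 x : 0 <= F x by apply: (potential_ge0 mu K0) => y; exact: poweR_ge0.
have mF : measurable_fun setT F.
  apply: (measurable_potential mu mK K0) => [|y]; last exact: poweR_ge0.
  apply: (measurableT_comp (measurable_poweR _)).
  exact: measurable_high_part.
have [f f0 Ff] : exists2 f : R, (0 < f)%R & \int[mu]_x F x `^ sigma <= f%:E.
  apply: ge0_fin_bound.
  exact: (potential_high_part_integrable p0 r0 sigma0 sigb psr del0 mU U0'' Ufin).
have [N N0 VN] := ge0_fin_bound Vfin.
have step a b x : measurable_fun setT a -> (forall y, 0 <= a y) ->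
    measurable_fun setT b -> (forall y, 0 <= b y) ->
    (forall y, V y <= a y + b y) ->
    V x <= c%:E * (lifting mu K p q (low_part U del) a x +
                   lifting mu K p q (low_part U del) b x) + F x.
  move=> ma a0 mb b0 Vab; rewrite VE.
  exact: (lifting_split mK K0 del x q0 pq1 mU U0' ma a0 mb b0 V0 Vab UE).
clearbody c F.
(* The solution of M = M/2 + 2^sigma f, so one iteration preserves the bound M. *)
pose M := (2 * (2 `^ sigma * f))%R.
have M0 : (0 < M)%R by rewrite !mulr_gt0// powR_gt0.
have ind (k : nat) : exists a b : T -> \bar R,
   [/\ measurable_fun setT a /\ (forall x, 0 <= a x),
      measurable_fun setT b /\ (forall x, 0 <= b x),
      forall x, V x <= a x + b x,
      \int[mu]_x a x `^ sigma <= M%:E &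
      \int[mu]_x b x `^ s <= (N * 2^-1 ^+ k)%:E].
  elim: k => [|k [a [b [[ma a0] [mb b0] Vab aM bN]]]].
    exists (cst 0), V; split => //.
    - by move=> x; rewrite add0e.
    - under eq_integral do rewrite poweR0r ?gt_eqF//.
      by rewrite integral0 lee_fin ltW.
    - by rewrite expr0 mulr1.
  pose Ta := lifting mu K p q (low_part U del) a.
  pose Tb := lifting mu K p q (low_part U del) b.
  have mTa : measurable_fun setT Ta by exact: measurable_lifting.
  have mTb : measurable_fun setT Tb by exact: measurable_lifting.
  have Ta0 x : 0 <= Ta x by exact: lifting_ge0.
  have Tb0 x : 0 <= Tb x by exact: lifting_ge0.
  have HS x : V x <= c%:E * (Ta x + Tb x) + F x by exact: step.
  have Nk0 : (0 < N * 2^-1 ^+ k)%R by rewrite mulr_gt0// exprn_gt0.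
  have HTa := hC2 _ _ _ _ mL L0 ma a0 eps0 M0 Udel aM.
  have HTb := hC1 _ _ _ _ mL L0 mb b0 eps0 Nk0 Udel bN.
  rewrite -/Ta in HTa; rewrite -/Tb in HTb; clearbody Ta Tb.
  (* F joins the part measured in L^sigma, so the part measured in L^s is halved at each
     iteration. *)
  exists (fun x => c%:E * Ta x + F x), (fun x => c%:E * Tb x).
  have cT0 t x : 0 <= t x -> 0 <= c%:E * (t : T -> \bar R) x.
    by move=> t0; rewrite mule_ge0// lee_fin ltW.
  have mpow t (w : T -> \bar R) : measurable_fun setT w ->
      measurable_fun setT (fun x => w x `^ t).
    by move=> mw; exact: (measurableT_comp (measurable_poweR _)).
  have pw0 t (w : T -> \bar R) x : 0 <= w x `^ t by exact: poweR_ge0.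
  have scale t (w : T -> \bar R) (m : R) : measurable_fun setT w ->
      (forall x, 0 <= w x) -> \int[mu]_x w x `^ t <= m%:E ->
      \int[mu]_x (c%:E * w x) `^ t <= (c `^ t * m)%:E.
    move=> mw w0 wm.
    under eq_integral do rewrite poweRM ?lee_fin ?(ltW c0)// poweR_EFin.
    rewrite ge0_integralZl ?lee_fin ?powR_ge0//; last exact: mpow.
    by rewrite EFinM lee_wpmul2l// lee_fin powR_ge0.
  split.
  - split; last by move=> x; rewrite adde_ge0 ?cT0.
    by apply: emeasurable_funD => //; exact: measurable_funeM.
  - by split; [exact: measurable_funeM|move=> x; exact: cT0].
  - move=> x; apply: (le_trans (HS x)).
    by rewrite ge0_muleDr// addeAC.
  - have H1 := scale sigma Ta _ mTa Ta0 HTa.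
    apply: (@le_trans _ _ (\int[mu]_x ((2 `^ sigma)%:E *
        ((c%:E * Ta x) `^ sigma + F x `^ sigma)))).
      apply: ge0_le_integralT => x; first exact: poweR_ge0.
      by apply: poweR_add_le => //; exact: cT0.
    have mcTa : measurable_fun setT (fun x => (c%:E * Ta x) `^ sigma).
      by apply: (mpow sigma (fun x => c%:E * Ta x)); exact: measurable_funeM.
    rewrite ge0_integralZl ?lee_fin ?powR_ge0//; last 2 first.
    + by apply: emeasurable_funD => //; exact: mpow.
    + by move=> x _; rewrite adde_ge0// poweR_ge0.
    rewrite ge0_integralD//; [|by move=> x _; exact: poweR_ge0|exact: mpow].
    apply: (@le_trans _ _ ((2 `^ sigma)%:E *
        ((c `^ sigma * (C2 * eps `^ g2 * M))%:E + f%:E))).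
      apply: lee_wpmul2l; first by rewrite lee_fin powR_ge0.
      by apply: leeD.
    rewrite -EFinD -EFinM lee_fin mulrDr.
    rewrite [leRHS](_ : M = 2^-1 * M + 2 `^ sigma * f)%R; last first.
      by rewrite /M mulKf ?pnatr_eq0// mulr_natl mulr2n.
    move: he2 (ltW M0); rewrite lerD2r; clear; clearbody M.
    move: (2 `^ sigma)%R (c `^ sigma)%R (eps `^ g2)%R => x1 x2 x3 he2 M0.
    have -> : (x1 * (x2 * (C2 * x3 * M)) = x1 * x2 * C2 * x3 * M)%R by ring.
    exact: ler_wpM2r.
  - have H1 := scale s Tb _ mTb Tb0 HTb.
    apply: le_trans H1 _; rewrite lee_fin !mulrA exprS.
    rewrite (_ : N * (2^-1 * 2^-1 ^+ k) = 2^-1 * (N * 2^-1 ^+ k))%R; last by rewrite mulrCA.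
    by rewrite -(mulrA _ N) ler_wpM2r// ltW.
exists M => e e0.
have [k hk] := exists_pow2_ge (N / e).
have [a [b [ha hb Vab aM bN]]] := ind k; exists a, b; split => //.
apply: (le_trans bN); rewrite lee_fin exprVn ler_pdivrMr ?exprn_gt0//.
by rewrite mulrC -ler_pdivrMr.
Qed.

(** Where V > [del], either V <= 2a and V^sigma <= 2^sigma a^sigma, or V <= 2b and, as sigma <= s,
    V^sigma <= del^(sigma - s) V^s <= del^(sigma - s) 2^s b^s. Since b can be taken arbitrarily
    small, the bound does not depend on [del], which then tends to 0. *)
Lemma fixpoint_integrable (p q r s sigma : R) (U V : T -> \bar R) :
  (0 < q)%R -> (1 < p * q)%R -> (0 < r)%R -> (0 < sigma)%R -> (sigma <= s)%R ->
  ((p - q^-1) / r = beta * (1 + q^-1))%R ->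
  (beta < q / s < 1)%R -> (s^-1 + beta < 1)%R ->
  (beta < q / sigma < 1)%R -> (sigma^-1 + beta < 1)%R ->
  (p / (sigma^-1 + beta) <= r)%R ->
  measurable_fun setT U -> (forall x, 0 < U x < +oo) ->
  measurable_fun setT V -> (forall x, 0 < V x < +oo) ->
  (forall x, U x = potential mu K (fun y => V y `^ q) x) ->
  (forall x, V x = potential mu K (fun y => U y `^ p) x) ->
  \int[mu]_x U x `^ r < +oo -> \int[mu]_x V x `^ s < +oo ->
  \int[mu]_x V x `^ sigma < +oo.
Proof.
move=> q0 pq1 r0 sigma0 sigs pr qs sb qsig sigb psr mU U0 mV V0 UE VE Ufin Vfin.
have s0 : (0 < s)%R by exact: lt_le_trans sigs.
have V0' x : 0 <= V x by case/andP: (V0 x) => /ltW.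
have [M hM] := fixpoint_decomposition q0 pq1 r0 sigma0 s0 pr qs sb qsig sigb
  psr mU U0 mV V0' UE VE Ufin Vfin.
have mVs : measurable_fun setT (fun x => V x `^ sigma).
  exact: (measurableT_comp (measurable_poweR _)).
apply: (@le_lt_trans _ _ (2 `^ sigma * M + 1)%:E); last exact: ltry.
apply: (@ge0_integral_le_positive _ _ _ _ _ V) => //.
- by move=> x; exact: poweR_ge0.
- by move=> x; case/andP: (V0 x).
move=> del del0.
(* The factor in front of b^s; choosing the s-integral of b at most 1/c makes that term contribute
   at most 1. *)
pose c := (del `^ (sigma - s) * 2 `^ s)%R.
have c0 : (0 < c)%R by rewrite mulr_gt0// powR_gt0.
have [a [b [[ma a0] [mb b0] Vab aM bc]]] := hM (c^-1)%R ltac:(by rewrite invr_gt0).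
have mas : measurable_fun setT (fun x => a x `^ sigma).
  exact: (measurableT_comp (measurable_poweR _)).
have mbs : measurable_fun setT (fun x => b x `^ s).
  exact: (measurableT_comp (measurable_poweR _)).
rewrite integral_mkcond.
apply: (@le_trans _ _ (\int[mu]_x
    ((2 `^ sigma)%:E * a x `^ sigma + c%:E * b x `^ s))); last first.
  rewrite ge0_integralD//; last 4 first.
  - by move=> x _; rewrite mule_ge0 ?poweR_ge0// lee_fin powR_ge0.
  - exact: measurable_funeM.
  - by move=> x _; rewrite mule_ge0 ?poweR_ge0// lee_fin ltW.
  - exact: measurable_funeM.
  rewrite !ge0_integralZl ?lee_fin ?powR_ge0 ?(ltW c0)//; last 2 first.
  - by move=> x _; exact: poweR_ge0.
  - by move=> x _; exact: poweR_ge0.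
  rewrite EFinD (EFinM (2 `^ sigma)%R M) leeD//.
    by rewrite lee_wpmul2l// lee_fin powR_ge0.
  apply: (@le_trans _ _ (c%:E * c^-1%:E)); last by rewrite -EFinM mulfV// gt_eqF.
  by rewrite lee_wpmul2l// lee_fin ltW.
apply: ge0_le_integralT => x.
  by rewrite patchE; case: ifP => // _; exact: poweR_ge0.
rewrite patchE; case: ifPn => [|_]; last first.
  by rewrite adde_ge0// mule_ge0 ?poweR_ge0// lee_fin ?powR_ge0// ltW.
rewrite inE /= => dV.
have dbl (t : R) (w : \bar R) : (0 < t)%R -> 0 <= w -> V x <= 2%:E * w ->
    V x `^ t <= (2 `^ t)%:E * w `^ t.
  move=> t0 w0 Vw; rewrite -poweR_EFin -poweRM ?lee_fin//.
  by apply: le_poweR => //; exact: ltW.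
have [ba|/ltW ab] := leP (b x) (a x).
  apply: (@le_trans _ _ ((2 `^ sigma)%:E * a x `^ sigma)).
    apply: dbl => //; apply: (le_trans (Vab x)).
    by rewrite mule_natl mule2n leeD2l.
  by rewrite leeDl// mule_ge0 ?poweR_ge0// lee_fin ltW.
apply: (@le_trans _ _ (c%:E * b x `^ s)); last first.
  by rewrite leeDr// mule_ge0 ?poweR_ge0// lee_fin powR_ge0.
rewrite /c EFinM -muleA.
apply: (@le_trans _ _ ((del `^ (sigma - s))%:E * V x `^ s)); last first.
  rewrite lee_wpmul2l ?lee_fin ?powR_ge0//; apply: dbl => //.
  by apply: (le_trans (Vab x)); rewrite mule_natl mule2n leeD2r.
case: (V x) (V0 x) dV => [w|/andP[]//|//] /andP[].
rewrite !lte_fin => w0 _ dw.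
have -> : w%:E `^ sigma = (w `^ (sigma - s))%:E * w%:E `^ s.
  rewrite !poweR_EFin -EFinM -powRD ?subrK//.
  by apply/implyP => _; rewrite gt_eqF.
rewrite lee_wpmul2r ?poweR_ge0// lee_fin -opprB !powRN.
rewrite lef_pV2 ?posrE ?powR_gt0//.
by rewrite ge0_ler_powR ?nnegrE ?subr_ge0 ?(ltW dw)// ltW.
Qed.

End regularity.

(** * Exponent arithmetic and the Riesz system *)

(** Multiplying the hypothesis by (p+1)(q+1) gives beta (p+1)(q+1) <= pq - 1, which is q + 1 <= s.
    The strict inequalities for s^-1 and (q+1)^-1 follow from this and from (p+1)^-1 > 0. *)
Lemma critical_exponents (R : realType) (n : nat) (alpha p q : R) :
  (0 < n)%N -> 0 < alpha -> 0 < p -> 0 < q -> 1 < p * q ->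
  (p + 1)^-1 + (q + 1)^-1 <= (n%:R - alpha) / n%:R ->
  let beta := alpha / n%:R in
  let r := n%:R * (p * q - 1) / (alpha * (q + 1)) in
  let s := n%:R * (p * q - 1) / (alpha * (p + 1)) in
  [/\ 0 < r, q + 1 <= s, (p - q^-1) / r = beta * (1 + q^-1),
      beta < q / s < 1 & s^-1 + beta < 1] /\
  [/\ beta < q / (q + 1) < 1, (q + 1)^-1 + beta < 1 &
      p / ((q + 1)^-1 + beta) <= r].
Proof.
move=> n0 a0 p0 q0 pq1 hpq beta r s.
have n0' : 0 < n%:R :> R by rewrite ltr0n.
have b0 : 0 < beta by rewrite divr_gt0.
have D0 : 0 < p * q - 1 by rewrite subr_gt0.
have p1 : 0 < p + 1 by rewrite addr_gt0.
have q1 : 0 < q + 1 by rewrite addr_gt0.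
have r0 : 0 < r by rewrite divr_gt0 ?mulr_gt0.
have s0 : 0 < s by rewrite divr_gt0 ?mulr_gt0.
have {}hpq : (p + 1)^-1 + (q + 1)^-1 <= 1 - beta.
  by rewrite (le_trans hpq)// mulrBl mulfV// gt_eqF.
have ivr : r^-1 = beta * (q + 1) / (p * q - 1).
  by rewrite /r /beta; field; rewrite !gt_eqF.
have ivs : s^-1 = beta * (p + 1) / (p * q - 1).
  by rewrite /s /beta; field; rewrite !gt_eqF.
clearbody r s beta.
have ip0 : 0 < (p + 1)^-1 by rewrite invr_gt0.
have qb : (q + 1)^-1 + beta < 1 by lra.
have key : beta * (p + 1) * (q + 1) <= p * q - 1.
  have : ((p + 1)^-1 + (q + 1)^-1) * ((p + 1) * (q + 1)) <=
      (1 - beta) * ((p + 1) * (q + 1)).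
    by rewrite ler_wpM2r// ltW// mulr_gt0.
  have -> : ((p + 1)^-1 + (q + 1)^-1) * ((p + 1) * (q + 1)) = p + q + 2.
    by field; rewrite !gt_eqF.
  by lra.
have isq : s^-1 <= (q + 1)^-1.
  by rewrite ivs ler_pdivrMr// ler_pdivlMl// mulrC.
have qs : q + 1 <= s by rewrite -lef_pV2.
have qq : q / (q + 1) = 1 - (q + 1)^-1 by field; rewrite gt_eqF.
have th0 : 0 < (q + 1)^-1 + beta by rewrite addr_gt0 ?invr_gt0.
split; split => //.
- by rewrite ivr; field; rewrite !gt_eqF.
- apply/andP; split.
    rewrite ivs mulrA ltr_pdivlMr//; nra.
  by rewrite ltr_pdivrMr// mul1r (lt_le_trans _ qs)// ltrDl.
- by apply: le_lt_trans qb; rewrite lerD2r.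
- by rewrite qq; apply/andP; split; rewrite ?gtrBl ?invr_gt0//; lra.
- rewrite ler_pdivrMr// -ler_pdivrMl// ivr.
  (* The scaling identity p/r = 1/s + beta reduces the last bound to q + 1 <= s. *)
  have -> : beta * (q + 1) / (p * q - 1) * p = s^-1 + beta.
    by rewrite ivs; field; rewrite gt_eqF.
  by rewrite lerD2r.
Qed.

Lemma inLpE (R : realType) (n : nat) (r : R) (f : n.-tuple R -> R) :
  measurable_fun [set: n.-tuple R] f -> (forall x, 0 < f x) ->
  integralRn (fun x => (`|f x| `^ r)%:E) =
  (\int[lebesgue_tuple R n]_x (f x)%:E `^ r)%E.
Proof.
move=> mf f0.
have -> : (fun x => (`|f x| `^ r)%:E) = (fun x => (f x)%:E `^ r)%E.
  by apply/funext => x; rewrite gtr0_norm.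
rewrite integralRnE// => [|x]; last exact: poweR_ge0.
apply: (measurableT_comp (measurable_poweR _)).
exact/measurable_EFinP.
Qed.

Lemma rieszE (R : realType) (n : nat) (alpha q : R) (f : n.-tuple R -> R) x :
  measurable_fun [set: n.-tuple R] f ->
  riesz alpha (fun y => f y `^ q) x =
  potential (lebesgue_tuple R n) (@riesz_kernel R n alpha)
    (fun y => (f y)%:E `^ q)%E x.
Proof.
move=> mf; rewrite /riesz integralRnE//.
- apply/measurable_EFinP; apply: measurable_funM.
    exact: (measurableT_comp (measurable_powR _) mf).
  apply/measurable_EFinP.
  exact: (measurableT_comp (@measurable_riesz_kernel R n alpha) (pair1_measurable x)).
- by move=> y; rewrite lee_fin divr_ge0 ?powR_ge0.
Qed.

(** The abstract result with beta = alpha/n, sigma = q + 1, r = r0 and s = s0. It concerns v alone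
    because the system is invariant under exchanging (u, p) and (v, q). *)
Lemma riesz_system_integrable (R : realType) (n : nat) (alpha p q : R)
    (u v : n.-tuple R -> R) :
  (0 < n)%N -> 0 < alpha -> alpha < n%:R ->
  0 < p -> 0 < q -> 1 < p * q ->
  (p + 1)^-1 + (q + 1)^-1 <= (n%:R - alpha) / n%:R ->
  inLp (n%:R * (p * q - 1) / (alpha * (q + 1))) u ->
  inLp (n%:R * (p * q - 1) / (alpha * (p + 1))) v ->
  (forall x, 0 < u x) -> (forall x, 0 < v x) ->
  (forall x, (u x)%:E = riesz alpha (fun y => v y `^ q) x) ->
  (forall x, (v x)%:E = riesz alpha (fun y => u y `^ p) x) ->
  inLp (q + 1) v.
Proof.
move=> n0 a0 an p0 q0 pq1 hpq [mu_ uL] [mv vL] u0 v0 uE vE.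
have n0' : 0 < n%:R :> R by rewrite ltr0n.
have [[r0 qs rE qsb sb] [qqb qb prs]] := critical_exponents n0 a0 p0 q0 pq1 hpq.
have beta01 : 0 < alpha / n%:R < 1.
  by rewrite divr_gt0//= ltr_pdivrMr// mul1r.
have hls (s t : R) : 0 < s < 1 -> 0 < t < 1 -> s + t = 1 + alpha / n%:R ->
    exists2 C : R, 0 < C &
      bilinear_bound (lebesgue_tuple R n) (@riesz_kernel R n alpha) s t C.
  by move=> hs ht st; apply: bilinear_bound_riesz => //; rewrite a0.
split=> //; rewrite inLpE//.
apply: (fixpoint_integrable (@measurable_riesz_kernel R n alpha)
  (@riesz_kernel_ge0 R n alpha) beta01 hls q0 pq1 r0 _ qs rE qsb sb qqb qb prs
  (U := EFin \o u) (V := EFin \o v)).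
- by rewrite addr_gt0.
- exact/measurable_EFinP.
- by move=> x; rewrite lte_fin u0 ltry.
- exact/measurable_EFinP.
- by move=> x; rewrite lte_fin v0 ltry.
- by move=> x /=; rewrite uE rieszE.
- by move=> x /=; rewrite vE rieszE.
- by rewrite -(inLpE _ mu_ u0).
- by rewrite -(inLpE _ mv v0).
Qed.

Unset Implicit Arguments.

Theorem theorem2p2 (R : realType) (n : nat) (alpha p q : R)
  (u v : n.-tuple R -> R) :
  (3 <= n)%N ->
  0 < alpha -> alpha < n%:R ->
  0 < p -> 0 < q -> 1 < p * q ->
  (p + 1)^-1 + (q + 1)^-1 <= (n%:R - alpha) / n%:R ->
  inLp (n%:R * (p * q - 1) / (alpha * (q + 1))) u ->
  inLp (n%:R * (p * q - 1) / (alpha * (p + 1))) v ->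
  (forall x, 0 < u x) -> (forall x, 0 < v x) ->
  (forall x, (u x)%:E = riesz alpha (fun y => v y `^ q) x) ->
  (forall x, (v x)%:E = riesz alpha (fun y => u y `^ p) x) ->
  inLp (p + 1) u /\ inLp (q + 1) v.
Proof.
move=> n3 a0 an p0 q0 pq1 hpq uL vL u0 v0 uE vE.
have n0 : (0 < n)%N by exact: leq_trans n3.
split; last exact: (riesz_system_integrable n0 a0 an p0 q0 pq1 hpq uL vL).
(* Exchanging the roles also exchanges r0 and s0, up to commutativity of p q and of the sum of
   reciprocals. *)
apply: (riesz_system_integrable (p := q) (q := p) (u := v) n0 a0 an) => //.
- by rewrite mulrC.
- by rewrite addrC.
- by rewrite (mulrC q).
- by rewrite (mulrC q).
Qed.
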